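(* For all complex $x,a,b,c,d,q$ with $|x|,|a|,|b|,|c|,|d|,|q|<1$ we have $$\frac{f_{AW}(x|a,b,c,d,q)}{f_{CH}(x|b,c,d,q)}=\frac{(ab,ac,ad)_\infty}{(abcd)_\infty}\varphi_h(x|a,q)=\sum_{n\ge0}\frac{a^n}{(abcd,q)_n}\psi_n(x|b,c,d,q),$$ $$\frac{f_{CH}(x|b,c,d,q)}{f_{AW}(x|a,b,c,d,q)}=\frac{(abcd)_\infty}{(ab,ac,ad)_\infty\,\varphi_h(x|a,q)}=\sum_{n\ge0}(-a)^nq^{\binom n2}\frac{(abcd)_{2n}}{(abcdq^{n-1})_n^2\,(ab,ac,ad,q)_n}\,w_n(x|a,b,c,d,q).$$
   Context: $(a)_n=\prod_{j=0}^{n-1}(1-aq^j)$, $(a)_\infty=\prod_{j\ge0}(1-aq^j)$, $(a_1,\ldots,a_k)_n=\prod_i(a_i)_n$ (also for $n=\infty$); empty products are $1$. Put $$f_h(x|q)=\frac{2(q)_\infty\sqrt{1-x^2}}\pi\prod_{k=1}^\infty\big((1+q^k)^2-4x^2q^k\big),\qquad \varphi_h(x|t,q)=\prod_{k=0}^\infty\frac1{1-2xtq^k+t^2q^{2k}},$$ $$f_{AW}(x|a,b,c,d,q)=f_h(x|q)\varphi_h(x|a,q)\varphi_h(x|b,q)\varphi_h(x|c,q)\varphi_h(x|d,q)\frac{(ab,ac,ad,bc,bd,cd)_\infty}{(abcd)_\infty},$$ $$f_{CH}(x|b,c,d,q)=(bc,bd,cd)_\infty f_h(x|q)\varphi_h(x|b,q)\varphi_h(x|c,q)\varphi_h(x|d,q).$$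 $w_n(x|a,b,c,d,q)$ are the Askey–Wilson polynomials normalized to have leading coefficient $2^n$ in $x$: for $a,q\ne0$, $$w_n(x|a,b,c,d,q)=\frac{(ab,ac,ad)_n}{a^n(abcdq^{n-1})_n}\sum_{k=0}^n\frac{(q^{-n})_k(abcdq^{n-1})_k\,q^k}{(ab,ac,ad,q)_k}\prod_{i=0}^{k-1}(1-2axq^i+a^2q^{2i}),$$ which is symmetric in $a,b,c,d$ and extends by continuity to $a=0$ and $q=0$. $\psi_n(x|b,c,d,q)=w_n(x|0,b,c,d,q)$ are the continuous dual $q$-Hahn polynomials.
   Formalization: The factor (abcdq^{n-1})_n^2 is removed from the second expansion (false as printed, e.g. q=0, a=b=c=d=1/2); the first series is claimed when |a|<|z| for both roots z of z^2-2xz+1 (it diverges otherwise; automatic for real x); the density quotients are claimed where f_CH is finite and nonzero. *)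

(* Defs.v *)
From HB Require Import structures.
From mathcomp Require Import all_boot all_order all_algebra.
From mathcomp Require Import all_classical all_reals all_analysis.
From mathcomp Require Import complex.

Set Implicit Arguments.
Unset Strict Implicit.
Unset Printing Implicit Defensive.

Import Order.TTheory GRing.Theory Num.Theory numFieldNormedType.Exports.
Local Open Scope classical_set_scope.
Local Open Scope complex_scope.
Local Open Scope ring_scope.

(* The topology of MathComp-Analysis is attached to abstract numeric fields,  *)
(* not to the concrete type R[i]; packing R[i] as a numClosedFieldType makes  *)
(* nbhs, lim and series available on the complex numbers.                     *)
Definition cplx (R : realType) : numClosedFieldType := R[i].

Section QSeries.
Variable C : numFieldType.
Implicit Types (a b c d q t x : C) (s : seq C).

Definition qpoch a q (n : nat) : C := \prod_(0 <= j < n) (1 - a * q ^+ j).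

Definition qpochs s q (n : nat) : C := \prod_(a <- s) qpoch a q n.

Definition infprod (F : nat -> C) : C :=
  lim ((\prod_(0 <= k < n) F k) @[n --> \oo]).

Definition qpochoo a q : C := infprod (fun j => 1 - a * q ^+ j).

Definition qpochsoo s q : C := \prod_(a <- s) qpochoo a q.

(* At a pole of phi_h some factor vanishes, and since 0^-1 = 0 the value is 0.*)
Definition phi_h x t q : C :=
  infprod (fun k => (1 - 2 * x * t * q ^+ k + t ^+ 2 * q ^+ (2 * k))^-1).

(* q ^+ n.-1 only departs from q^(n-1) at n = 0, where it occurs solely       *)
(* inside empty products and in a factor (_)_k with k = 0.                    *)
Definition askey_wilson_formula (n : nat) x a b c d q : C :=
  qpochs [:: a * b; a * c; a * d] q n
    / (a ^+ n * qpoch (a * b * c * d * q ^+ n.-1) q n)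
  * \sum_(0 <= k < n.+1)
      qpoch (q ^- n) q k * qpoch (a * b * c * d * q ^+ n.-1) q k * q ^+ k
        / qpochs [:: a * b; a * c; a * d; q] q k
      * \prod_(0 <= i < k)
          (1 - 2 * a * x * q ^+ i + a ^+ 2 * q ^+ (2 * i)).

(* The formula has removable singularities along a = 0 and q = 0; there the   *)
(* polynomial is the limit of the formula as (a', q') -> (a, q), a', q' != 0. *)
Definition askey_wilson (n : nat) x a b c d q : C :=
  if (a != 0) && (q != 0) then askey_wilson_formula n x a b c d q
  else lim (askey_wilson_formula n x p.1 b c d p.2
              @[p --> within [set p : C * C | p.1 != 0 /\ p.2 != 0]
                             (nbhs (a, q))]).

Definition cdual_qhahn (n : nat) x b c d q : C := askey_wilson n x 0 b c d q.

End QSeries.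

Section Densities.
Variable R : realType.
Implicit Types x a b c d q : cplx R.

(* sqrtc is the principal branch (nonnegative real part), unlike sqrtC.       *)
Definition f_h x q : cplx R :=
  2 * qpochoo q q * (sqrtc (1 - x ^+ 2) : cplx R) / (pi%:C : cplx R)
  * infprod (fun k => (1 + q ^+ k.+1) ^+ 2 - 4 * x ^+ 2 * q ^+ k.+1).

Definition f_AW x a b c d q : cplx R :=
  f_h x q * phi_h x a q * phi_h x b q * phi_h x c q * phi_h x d q
  * (qpochsoo [:: a * b; a * c; a * d; b * c; b * d; c * d] q
     / qpochoo (a * b * c * d) q).

Definition f_CH x b c d q : cplx R :=
  qpochsoo [:: b * c; b * d; c * d] q
  * f_h x q * phi_h x b q * phi_h x c q * phi_h x d q.

End Densities.

(* Main.v *)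
(* The expansion of f_CH / f_AW.  After substituting the defining sum of w_n,
   the sum over n <= N telescopes in n for each fixed summation index k and leaves
     sum_(k <= N) e_(N-k) / (q)_k * g(N, k),   e_m = (-1)^m q^C(m+1,2) / (q)_m,
   where g(N, k) tends to the right-hand side as k grows.  By the finite
   q-binomial theorem the weights e_(N-k) / (q)_k sum to 1, and they are
   O(|q|^(N-k)), so this is a Toeplitz mean of a convergent array.  (Exchanging
   the two infinite summations is not legitimate: every inner sum is 0.)

   The expansion of f_AW / f_CH.  The polynomials w_n satisfy a three-term
   recurrence whose coefficients stay regular at a = 0 and q = 0; this computes
   the limits defining psi_n.  The recurrence makes the difference of the partial
   sums of the two sides of
     (1 - tbcd) (1 - 2tx + t^2) F(t) = (1 - tb) (1 - tc) (1 - td) F(tq),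
     F(t) = sum_n t^n psi_n / (tbcd, q)_n,
   telescope, and iterating from t = a, with F(a q^N) -> 1, gives the product.
   Convergence comes from |psi_n| = O(max(|z|, |1/z|)^n), z + 1/z = 2x. *)

Require Import Defs.
From HB Require Import structures.
From mathcomp Require Import all_boot all_order all_algebra.
From mathcomp Require Import all_classical all_reals all_analysis.
From mathcomp Require Import complex ring lra zify.

Set Implicit Arguments.
Unset Strict Implicit.
Unset Printing Implicit Defensive.

Import Order.TTheory GRing.Theory Num.Theory numFieldNormedType.Exports.
Local Open Scope classical_set_scope.
Local Open Scope ring_scope.

Section Pochhammer.
Variable C : numFieldType.
Implicit Types (a b c d q t u x : C).

Lemma qpoch0 u q : qpoch u q 0 = 1.
Proof. by rewrite /qpoch big_geq. Qed.

Lemma qpochS u q n : qpoch u q n.+1 = qpoch u q n * (1 - u * q ^+ n).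
Proof. by rewrite /qpoch big_nat_recr. Qed.

Lemma qpoch1 u q : qpoch u q 1 = 1 - u.
Proof. by rewrite qpochS qpoch0 mul1r mulr1. Qed.

Lemma qpochSl u q n : qpoch u q n.+1 = (1 - u) * qpoch (u * q) q n.
Proof.
rewrite /qpoch big_nat_recl//= expr0 mulr1; congr (_ * _).
by apply: eq_bigr => i _; rewrite exprS mulrA.
Qed.

Lemma qpoch_shift u q n : 1 - u != 0 ->
  qpoch (u * q) q n = qpoch u q n * (1 - u * q ^+ n) / (1 - u).
Proof. by move=> u1; rewrite -qpochS qpochSl mulrAC mulfV// mul1r. Qed.

Lemma qpochD u q m n : qpoch u q (m + n) = qpoch u q m * qpoch (u * q ^+ m) q n.
Proof.
elim: n => [|n IH]; first by rewrite addn0 qpoch0 mulr1.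
by rewrite addnS !qpochS IH -!mulrA -exprD.
Qed.

Lemma qpochs0 s q : qpochs s q 0 = 1.
Proof. by rewrite /qpochs big1// => u _; rewrite qpoch0. Qed.

Lemma qpochs_cons u s q n : qpochs (u :: s) q n = qpoch u q n * qpochs s q n.
Proof. by rewrite /qpochs big_cons. Qed.

Lemma qpochs_nil q n : qpochs [::] q n = 1 :> C.
Proof. by rewrite /qpochs big_nil. Qed.

Definition qpochsE := (qpochs_cons, qpochs_nil, mulr1).

Lemma subr_neq0_norm u : `|u| < 1 -> 1 - u != 0.
Proof.
by move=> u1; rewrite subr_eq0; apply: contraTneq u1 => <-; rewrite normr1 ltxx.
Qed.

Lemma normM_lt1 a b : `|a| < 1 -> `|b| < 1 -> `|a * b| < 1.
Proof. by move=> a1 b1; rewrite normrM mulr_ilt1. Qed.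

Lemma normMX_lt1 u q n : `|u| < 1 -> `|q| < 1 -> `|u * q ^+ n| < 1.
Proof.
move=> u1 q1; rewrite normrM normrX (le_lt_trans _ u1)//.
by rewrite ler_piMr// exprn_ile1// ltW.
Qed.

Lemma qpoch_neq0 u q n : `|u| < 1 -> `|q| < 1 -> qpoch u q n != 0.
Proof.
move=> u1 q1; elim: n => [|n IH]; first by rewrite qpoch0 oner_eq0.
by rewrite qpochS mulf_neq0// subr_neq0_norm// normMX_lt1.
Qed.

Lemma qpochVn q k m : q != 0 ->
  qpoch (q ^- (k + m)) q k * (- 1) ^+ k * q ^+ ('C(k + m, 2) + k)
    * qpoch q q m = q ^+ 'C(m, 2) * qpoch q q (k + m).
Proof.
move=> q0; elim: k => [|k IH].
  by rewrite qpoch0 expr0 !mul1r add0n addn0.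
rewrite addSn qpochSl binS bin1.
have -> : q ^- (k + m).+1 * q = q ^- (k + m).
  by rewrite exprS invfM mulrAC mulVf// mul1r.
rewrite (qpochS q q (k + m)) mulrA -IH.
have -> : ('C(k + m, 2) + (k + m) + k.+1 = 'C(k + m, 2) + k + (k + m).+1)%N by lia.
rewrite (exprD q _ (k + m).+1) -exprS [(- 1) ^+ k.+1]exprS.
have Q0 : q ^+ (k + m).+1 != 0 by rewrite expf_neq0.
set Q := q ^+ (k + m).+1 in Q0 *.
by field.
Qed.

Lemma qbinomial_invsum q t N : `|q| < 1 ->
  \sum_(0 <= k < N.+1) (- t) ^+ k * q ^+ 'C(k, 2)
    / (qpoch q q k * qpoch q q (N - k)) = qpoch t q N / qpoch q q N.
Proof.
move=> q1; have Q0 n : qpoch q q n != 0 by rewrite qpoch_neq0.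
elim: N => [|N IH].
  by rewrite big_nat1 subn0 !qpoch0 !expr0 !mulr1.
have q0 : 1 - q * q ^+ N != 0 by rewrite subr_neq0_norm// normMX_lt1.
apply: (mulfI q0); rewrite !qpochS.
rewrite [RHS](_ : _ = (1 - t * q ^+ N) * (qpoch t q N / qpoch q q N)); last first.
  by field; rewrite q0 Q0.
rewrite -IH [LHS]mulr_sumr [RHS]mulrBl mul1r [in X in _ = _ - X]mulr_sumr.
pose T k := (- t) ^+ k * q ^+ 'C(k, 2) / (qpoch q q k * qpoch q q (N - k)).
pose A k := if k == N.+1 then 0 else T k.
pose B k := if k is k'.+1 then - (t * q ^+ N * T k') else 0.
rewrite (@eq_big_nat _ _ _ _ _ _ (fun k => A k + B k)).
  rewrite big_split/= big_nat_recr//= {2}/A eqxx addr0.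
  rewrite [in X in _ + X]big_nat_recl// [B 0%N]/(0) add0r -[in RHS]sumrN.
  by congr (_ + _); apply: eq_big_nat => k /andP[_ kN]; rewrite /A ltn_eqF.
rewrite /A /B /T => k /andP[_ kN].
case: k kN => [|k] kN.
  by rewrite /= !subn0 !expr0 qpoch0 qpochS addr0; field; rewrite q0 Q0.
rewrite eqSS subSS; case: eqVneq => [->|kN'].
  rewrite subnn !qpoch0 qpochS binS bin1 exprD !exprS; field.
  by rewrite Q0.
have {kN kN'} kN : (k < N)%N by lia.
have [m ->] : exists m, N = (k + m).+1 by exists (N - k.+1)%N; lia.
have -> : ((k + m).+1 - k = m.+1)%N by lia.
have -> : ((k + m).+1 - k.+1 = m)%N by lia.
rewrite !qpochS binS bin1 !exprD !exprS exprD.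
have [] := (subr_neq0_norm (normMX_lt1 k q1 q1), subr_neq0_norm (normMX_lt1 m q1 q1)).
by move=> k0 m0; field; rewrite k0 m0 !Q0.
Qed.

End Pochhammer.

Section InverseExpansion.
Variable C : numFieldType.
Implicit Types (a b c d q s t u x : C).

Definition aw_basis x a q k : C :=
  \prod_(0 <= i < k) (1 - 2 * a * x * q ^+ i + a ^+ 2 * q ^+ (2 * i)).

Lemma aw_basis0 x a q : aw_basis x a q 0 = 1.
Proof. by rewrite /aw_basis big_geq. Qed.

Lemma aw_basisS x a q k : aw_basis x a q k.+1 =
  aw_basis x a q k * (1 - 2 * a * x * q ^+ k + a ^+ 2 * q ^+ (2 * k)).
Proof. by rewrite /aw_basis big_nat_recr. Qed.

(* The contribution of the k-th summand of w_n to the n-th term of the expansion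
   is tau s q n k times a quantity independent of n, with s = abcd. *)
Let tau s q n k : C :=
  (- 1) ^+ n * q ^+ 'C(n, 2) * qpoch s q (2 * n)
  / (qpoch q q n * qpoch (s * q ^+ n.-1) q n)
  * (qpoch (q ^- n) q k * qpoch (s * q ^+ n.-1) q k * q ^+ k).

Definition euler_coef q m : C := (- 1) ^+ m * q ^+ 'C(m.+1, 2) / qpoch q q m.

Lemma tauE s q k m : q != 0 -> `|q| < 1 -> `|s| < 1 ->
  tau s q (k + m).+1 k = (- 1) ^+ m.+1 * q ^+ 'C(m.+1, 2) / qpoch q q m.+1
    * qpoch s q (k + m + k) * (1 - s * q ^+ (2 * (k + m)).+1).
Proof.
move=> q0 q1 s1.
have Q0 n : qpoch q q n != 0 by rewrite qpoch_neq0.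
have S0 j n : qpoch (s * q ^+ j) q n != 0 by rewrite qpoch_neq0// normMX_lt1.
have := qpochVn k m.+1 q0; rewrite addnS => e.
rewrite /tau/= [qpoch s q (k + m + k)]qpochD.
rewrite (_ : 2 * (k + m).+1 = (k + m) + (k + m).+1 + 1)%N; last by lia.
rewrite qpochD (qpochD s q (k + m)) qpoch1.
rewrite (_ : k + m + (k + m).+1 = (2 * (k + m)).+1)%N; last by lia.
have {}e : (-1) ^+ (k + m).+1 * q ^+ 'C((k + m).+1, 2)
    * qpoch (q ^- (k + m).+1) q k * q ^+ k
    = (-1) ^+ m.+1 * q ^+ 'C(m.+1, 2) * qpoch q q (k + m).+1 / qpoch q q m.+1.
  rewrite -(mulrA ((-1) ^+ m.+1)) -e -addnS !exprD.
  by field; rewrite Q0.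
have -> : forall A B D E F G H : C, A * B * D / E * (F * G * H) =
   (A * B * F * H) * D / E * G by move=> *; ring.
by rewrite e; field; rewrite !Q0 !S0.
Qed.

Lemma tau_diag s q n : q != 0 -> `|q| < 1 -> `|s| < 1 ->
  tau s q n n = qpoch s q (2 * n).
Proof.
move=> q0 q1 s1.
have Q0 : qpoch q q n != 0 by rewrite qpoch_neq0.
have S0 j : qpoch (s * q ^+ j) q n != 0 by rewrite qpoch_neq0// normMX_lt1.
have := qpochVn n 0 q0; rewrite addn0 qpoch0 mulr1 bin0n expr0 mul1r => e.
transitivity (qpoch q q n / qpoch q q n * qpoch s q (2 * n)); last first.
  by rewrite mulfV// mul1r.
rewrite /tau -[X in _ = X / _ * _]e exprD.
by field; rewrite Q0 S0.
Qed.

Lemma tau_telescope s q N k : q != 0 -> `|q| < 1 -> `|s| < 1 -> (k <= N)%N ->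
  euler_coef q (N - k) * qpoch s q (N + k) + tau s q N.+1 k
  = euler_coef q (N.+1 - k) * qpoch s q (N.+1 + k).
Proof.
move=> q0 q1 s1 kN.
have Q0 n : qpoch q q n != 0 by rewrite qpoch_neq0.
have [m ->] : exists m, N = (k + m)%N by exists (N - k)%N; lia.
rewrite tauE// -addnS !addKn /euler_coef addnS addSn (qpochS s) (qpochS q q).
rewrite (binS m.+1) bin1 exprD [in (-1) ^+ m.+1]exprS.
rewrite (_ : (2 * (k + m)).+1 = (k + m + k) + m.+1)%N; last by lia.
rewrite exprD exprS.
have q' : 1 - q * q ^+ m != 0 by rewrite subr_neq0_norm// normMX_lt1.
by field; rewrite Q0 q'.
Qed.

Lemma inverse_expansion_partial (x a b c d q : C) N :
  a != 0 -> q != 0 -> `|q| < 1 -> `|a| < 1 -> `|b| < 1 -> `|c| < 1 -> `|d| < 1 ->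
  \sum_(0 <= n < N.+1)
        (- a) ^+ n * q ^+ 'C(n, 2)
        * (qpoch (a * b * c * d) q (2 * n)
           / qpochs [:: a * b; a * c; a * d; q] q n)
        * askey_wilson_formula n x a b c d q
  = \sum_(0 <= k < N.+1) euler_coef q (N - k) * qpoch (a * b * c * d) q (N + k)
       * (aw_basis x a q k / qpochs [:: a * b; a * c; a * d; q] q k).
Proof.
move=> a0 q0 q1 a1 b1 c1 d1; set s := a * b * c * d.
have s1 : `|s| < 1 by rewrite !normM_lt1.
pose P k := aw_basis x a q k / qpochs [:: a * b; a * c; a * d; q] q k.
have E n : (- a) ^+ n * q ^+ 'C(n, 2) * (qpoch s q (2 * n)
           / qpochs [:: a * b; a * c; a * d; q] q n)
        * askey_wilson_formula n x a b c d q
     = \sum_(0 <= k < n.+1) tau s q n k * P k.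
  rewrite /askey_wilson_formula -/s mulrA mulr_sumr.
  apply: eq_bigr => k _; rewrite -/(aw_basis _ _ _ _) /P /tau.
  rewrite !qpochsE (exprNn a).
  have a'0 : a ^+ n != 0 by rewrite expf_neq0.
  have Q0 m u : `|u| < 1 -> qpoch u q m != 0 by move=> ?; rewrite qpoch_neq0.
  by field; rewrite a'0 !Q0 ?normMX_lt1 ?normM_lt1.
rewrite (eq_bigr _ (fun n _ => E n)) -/s {E}.
elim: N => [|N IH].
  rewrite !big_nat1 /tau /euler_coef !addn0 !qpoch0 !expr0/= ?expr0.
  by rewrite !mulr1 invr1 !mulr1.
rewrite big_nat_recr//= IH [X in _ + X = _]big_nat_recr//= [in RHS]big_nat_recr//=.
rewrite addrA -big_split/=; congr (_ + _); last first.
  rewrite tau_diag// subnn /euler_coef qpoch0 bin_small// !expr0 invr1.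
  by rewrite addnn mul2n !mul1r.
apply: eq_big_nat => k /andP[_ kN].
by rewrite -mulrDl tau_telescope.
Qed.

End InverseExpansion.

Section RecurrenceCoefficients.
Variable C : numFieldType.
Implicit Types (a b c d q s u x V J : C).

(* With A_n, C_n the coefficients in Koekoek-Lesky-Swarttouw (14.1.4) and
   V = q^m, aw_drop is C_(m+1) / a and aw_rise is 1 / a - A_(m+1), with the
   pole at a = 0 cancelled; aw_beta m and aw_gamma m multiply w_(m+1) and w_m
   in the recurrence for w_(m+2). *)
Definition aw_drop V a b c d q : C :=
  (1 - V * q) * (1 - b * c * V) * (1 - b * d * V) * (1 - c * d * V)
  / ((1 - a * b * c * d * V ^+ 2) * (1 - a * b * c * d * V ^+ 2 * q)).

Definition aw_rise V a b c d q : C :=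
  let e1 := b + c + d in let e2 := b * c + b * d + c * d in let e3 := b * c * d in
  let U := V * q in
  (- e3 * U * V - e3 * U ^+ 2 + a * e3 ^+ 2 * U ^+ 3 * V
   + U * e1 - a * U ^+ 2 * e2 + a ^+ 2 * U ^+ 3 * e3
   + V * e3 * (1 - a * U * e1 + a ^+ 2 * U ^+ 2 * e2 - a ^+ 3 * U ^+ 3 * e3))
  / ((1 - a * b * c * d * V ^+ 2 * q) * (1 - a * b * c * d * V ^+ 2 * q ^+ 2)).

Definition aw_beta m a b c d q : C :=
  a + aw_rise (q ^+ m) a b c d q - a * aw_drop (q ^+ m) a b c d q.

(* The truncated predecessors make the first quotient equal to 1 at m = 0,
   where the factor 1 - s q^-1 of A_0 cancels. *)
Definition aw_gamma m a b c d q : C :=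
  (1 - a * b * c * d * q ^+ m.-1) / (1 - a * b * c * d * q ^+ (2 * m).-1)
  * ((1 - a * b * q ^+ m) * (1 - a * c * q ^+ m) * (1 - a * d * q ^+ m))
  / (1 - a * b * c * d * q ^+ m ^+ 2) * aw_drop (q ^+ m) a b c d q.

Definition aw_den a b c d q J :=
  (1 - a * b * J) * (1 - a * c * J) * (1 - a * d * J) * (1 - q * J).

(* Coefficient quotients in the basis aw_basis, with V = q^n and J = q^k: the
   (k+1)-st coefficients of w_(n+1), w_(n+2) and gamma_n w_n, each divided by the
   k-th coefficient of w_(n+1). *)
Definition aw_ratio a b c d q V J : C :=
  (1 - J / (V * q)) * (1 - a * b * c * d * V * J) * q / aw_den a b c d q J.

Definition aw_ratio_up a b c d q V J : C :=
  (1 - a * b * (V * q)) * (1 - a * c * (V * q)) * (1 - a * d * (V * q))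
  / (a * (1 - a * b * c * d * V ^+ 2 * q) * (1 - a * b * c * d * V ^+ 2 * q ^+ 2))
  * (1 - (V * q * q)^-1) * (1 - a * b * c * d * V * J) * (1 - a * b * c * d * (V * q) * J)
  * q / aw_den a b c d q J.

Definition aw_ratio_down a b c d q V J : C :=
  a * aw_drop V a b c d q * (1 - a * b * c * d * V / q) * (1 - J / (V * q)) * (1 - J / V)
  / (1 - (V * q)^-1) * q / aw_den a b c d q J.

Lemma aw_ratio_identity a b c d q V J :
  a != 0 -> q != 0 -> V != 0 -> J != 0 -> 1 - V * q != 0 ->
  1 - a * b * c * d * V ^+ 2 != 0 -> 1 - a * b * c * d * V ^+ 2 * q != 0 ->
  1 - a * b * c * d * V ^+ 2 * q ^+ 2 != 0 -> aw_den a b c d q J != 0 ->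
  ((a * (q * J))^-1 + a * (q * J) - (a + aw_rise V a b c d q - a * aw_drop V a b c d q))
    * aw_ratio a b c d q V J - (a * J)^-1
  = aw_ratio_up a b c d q V J + aw_ratio_down a b c d q V J.
Proof.
rewrite /aw_den !mulf_eq0 !negb_or => a0 q0 V0 J0 U1 s0 s1 s2.
case/andP => /andP[/andP[abJ acJ] adJ] qJ.
have U1' : V * q - 1 != 0 by rewrite -oppr_eq0 opprB.
rewrite /aw_ratio /aw_ratio_up /aw_ratio_down /aw_rise /aw_drop /aw_den /=.
by field; rewrite a0 q0 V0 J0 U1' s0 s1 s2 abJ acJ adJ qJ.
Qed.

Definition aw_prefix n a b c d q : C :=
  qpochs [:: a * b; a * c; a * d] q n
    / (a ^+ n * qpoch (a * b * c * d * q ^+ n.-1) q n).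

Definition aw_body n a b c d q k : C :=
  qpoch (q ^- n) q k * qpoch (a * b * c * d * q ^+ n.-1) q k * q ^+ k
    / qpochs [:: a * b; a * c; a * d; q] q k.

Definition aw_coef n a b c d q k : C :=
  aw_prefix n a b c d q * aw_body n a b c d q k.

Lemma aw_formula_coef n x a b c d q : askey_wilson_formula n x a b c d q
   = \sum_(0 <= k < n.+1) aw_coef n a b c d q k * aw_basis x a q k.
Proof.
rewrite /askey_wilson_formula mulr_sumr; apply: eq_bigr => k _.
by rewrite -/(aw_basis _ _ _ _) mulrA.
Qed.

Lemma qpochVn_eq0 q n k : q != 0 -> (n < k)%N -> qpoch (q ^- n) q k = 0.
Proof.
move=> q0 nk; apply/eqP; rewrite prodf_seq_eq0; apply/hasP; exists n.
  by rewrite mem_index_iota.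
by rewrite /= mulVf ?subrr// expf_neq0.
Qed.

Lemma aw_body_eq0 n a b c d q k : q != 0 -> (n < k)%N -> aw_body n a b c d q k = 0.
Proof. by move=> q0 nk; rewrite /aw_body qpochVn_eq0// !mul0r. Qed.

Lemma aw_coef_eq0 n a b c d q k : q != 0 -> (n < k)%N -> aw_coef n a b c d q k = 0.
Proof. by move=> q0 nk; rewrite /aw_coef aw_body_eq0// mulr0. Qed.

Lemma aw_coefS n a b c d q k : a != 0 -> q != 0 -> `|q| < 1 ->
  `|a| < 1 -> `|b| < 1 -> `|c| < 1 -> `|d| < 1 ->
  aw_coef n.+1 a b c d q k.+1
  = aw_coef n.+1 a b c d q k * aw_ratio a b c d q (q ^+ n) (q ^+ k).
Proof.
move=> a0 q0 q1 a1 b1 c1 d1.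
have Q0 m u : `|u| < 1 -> qpoch u q m != 0 by move=> ?; rewrite qpoch_neq0.
have Q1 m u : `|u| < 1 -> 1 - u * q ^+ m != 0.
  by move=> ?; rewrite subr_neq0_norm// normMX_lt1.
rewrite /aw_coef /aw_prefix /aw_body /aw_ratio /aw_den !qpochsE !qpochS !exprS/=.
by field; rewrite ?Q1 ?q0 ?a0 ?Q0 ?expf_neq0 ?normMX_lt1 ?normM_lt1.
Qed.

Lemma aw_prefix_up n a b c d q : a != 0 -> `|q| < 1 ->
  `|a| < 1 -> `|b| < 1 -> `|c| < 1 -> `|d| < 1 ->
  aw_prefix n.+2 a b c d q = aw_prefix n.+1 a b c d q *
   ((1 - a * b * (q ^+ n * q)) * (1 - a * c * (q ^+ n * q)) * (1 - a * d * (q ^+ n * q))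
    * (1 - a * b * c * d * q ^+ n)
    / (a * (1 - a * b * c * d * q ^+ n ^+ 2 * q)
       * (1 - a * b * c * d * q ^+ n ^+ 2 * q ^+ 2))).
Proof.
move=> a0 q1 a1 b1 c1 d1; have s1 : `|a * b * c * d| < 1 by rewrite !normM_lt1.
rewrite /aw_prefix !qpochsE (qpochS (a * b)) (qpochS (a * c)) (qpochS (a * d)).
rewrite -[n.+2.-1]/(n.+1) -[n.+1.-1]/n.
set s := a * b * c * d in s1 *.
have -> : s * q ^+ n.+1 = s * q ^+ n * q by rewrite exprSr mulrA.
have S0 m : 1 - s * q ^+ m != 0 by rewrite subr_neq0_norm// normMX_lt1.
rewrite qpoch_shift// (qpochS _ q n.+1).
have -> : s * q ^+ n * q ^+ n.+1 = s * q ^+ n ^+ 2 * q.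
  by rewrite exprSr; ring.
have -> : s * q ^+ n * q ^+ n.+2 = s * q ^+ n ^+ 2 * q ^+ 2.
  by rewrite !exprSr expr0; ring.
rewrite -exprSr (exprS a n.+1).
have T0 := S0 n.
have T1 : 1 - s * q ^+ n ^+ 2 * q != 0 by rewrite -exprM -mulrA -exprSr S0.
have T2 : 1 - s * q ^+ n ^+ 2 * q ^+ 2 != 0 by rewrite -exprM -mulrA -exprD S0.
have G0 : qpoch (s * q ^+ n) q n.+1 != 0 by rewrite qpoch_neq0// normMX_lt1.
have A0 : a ^+ n.+1 != 0 by rewrite expf_neq0.
move: (1 - s * q ^+ n) T0 (1 - _ * q) T1 (1 - _ * q ^+ 2) T2 => T0 T00 T1 T10 T2 T20.
move: (qpoch (s * q ^+ n) q n.+1) G0 (a ^+ n.+1) A0 => G G0 A A0.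
move: (1 - a * b * _) (1 - a * c * _) (1 - a * d * _) => Ab Ac Ad.
by field; rewrite a0 T00 T10 T20 G0 A0.
Qed.

Lemma aw_prefix_down n a b c d q : a != 0 -> `|q| < 1 ->
  `|a| < 1 -> `|b| < 1 -> `|c| < 1 -> `|d| < 1 ->
  aw_gamma n a b c d q * aw_prefix n a b c d q
  = aw_prefix n.+1 a b c d q * (a * aw_drop (q ^+ n) a b c d q).
Proof.
move=> a0 q1 a1 b1 c1 d1; have s1 : `|a * b * c * d| < 1 by rewrite !normM_lt1.
rewrite /aw_prefix /aw_gamma; move: (aw_drop _ _ _ _ _ _) => D.
rewrite !qpochsE (qpochS (a * b)) (qpochS (a * c)) (qpochS (a * d)).
set s := a * b * c * d in s1 *.
have S0 m : 1 - s * q ^+ m != 0 by rewrite subr_neq0_norm// normMX_lt1.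
case: n => [|n].
  have := S0 0%N; rewrite (qpoch1 (s * _)) !qpoch0 !expr0 !expr1 ?expr1n !mulr1 => T0.
  move: (1 - s) T0 (1 - a * b) (1 - a * c) (1 - a * d) => T0 T00 Ab Ac Ad.
  by field; rewrite a0 T00.
rewrite (_ : (2 * n.+1).-1 = n + n.+1)%N; last by lia.
rewrite -[n.+2.-1]/(n.+1) -[n.+1.-1]/n.
have e : s * q ^+ n.+1 = s * q ^+ n * q by rewrite exprSr mulrA.
rewrite [in qpoch (s * q ^+ n.+1)]e qpoch_shift// (qpochS _ q n.+1).
have -> : s * q ^+ n * q ^+ n.+1 = s * q ^+ (n + n.+1) by rewrite exprD mulrA.
have -> : s * q ^+ n * q ^+ n.+2 = s * q ^+ n.+1 ^+ 2.
  by rewrite !exprSr expr0; ring.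
have T0 := S0 n; have T1 := S0 (n + n.+1)%N; have T2 := S0 (n.+1 * 2)%N.
rewrite exprM in T2.
have G0 : qpoch (s * q ^+ n) q n.+1 != 0 by rewrite qpoch_neq0// normMX_lt1.
have A0 : a ^+ n.+1 != 0 by rewrite expf_neq0.
rewrite (exprS a n.+1).
move: (1 - s * q ^+ n) T0 (1 - s * q ^+ (n + n.+1)) T1 (1 - s * q ^+ n.+1 ^+ 2) T2
  => T0 T00 T1 T10 T2 T20.
move: (qpoch (s * q ^+ n) q n.+1) G0 (a ^+ n.+1) A0 => G G0 A A0.
move: (1 - a * b * _) (1 - a * c * _) (1 - a * d * _) => Ab Ac Ad.
by field; rewrite a0 T00 T10 T20 G0 A0.
Qed.

Lemma qpochs4S a b c d q k :
  qpochs [:: a * b; a * c; a * d; q] q k.+1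
  = qpochs [:: a * b; a * c; a * d; q] q k * aw_den a b c d q (q ^+ k).
Proof.
rewrite !qpochsE !qpochS /aw_den.
move: (qpoch _ _ _) (qpoch _ _ _) (qpoch _ _ _) (qpoch _ _ _) => A B D E.
by move: (1 - _) (1 - _) (1 - _) (1 - _) => *; ring.
Qed.

Lemma qpochs4_neq0 a b c d q k : `|q| < 1 ->
  `|a| < 1 -> `|b| < 1 -> `|c| < 1 -> `|d| < 1 ->
  qpochs [:: a * b; a * c; a * d; q] q k != 0.
Proof. by move=> *; rewrite !qpochsE !mulf_neq0// qpoch_neq0 ?normM_lt1. Qed.

Lemma aw_den_neq0 a b c d q k : `|q| < 1 ->
  `|a| < 1 -> `|b| < 1 -> `|c| < 1 -> `|d| < 1 ->
  aw_den a b c d q (q ^+ k) != 0.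
Proof.
by move=> *; rewrite /aw_den !mulf_neq0// subr_neq0_norm ?normMX_lt1 ?normM_lt1.
Qed.

Lemma aw_coef_up n a b c d q k : a != 0 -> q != 0 -> `|q| < 1 ->
  `|a| < 1 -> `|b| < 1 -> `|c| < 1 -> `|d| < 1 ->
  aw_coef n.+2 a b c d q k.+1
  = aw_coef n.+1 a b c d q k * aw_ratio_up a b c d q (q ^+ n) (q ^+ k).
Proof.
move=> a0 q0 q1 a1 b1 c1 d1; have s1 : `|a * b * c * d| < 1 by rewrite !normM_lt1.
rewrite /aw_coef aw_prefix_up// /aw_body /aw_ratio_up qpochs4S.
rewrite -[n.+2.-1]/(n.+1) -[n.+1.-1]/n (qpochSl (q ^- _)).
have -> : q ^- n.+2 * q = q ^- n.+1.
  by rewrite [q ^+ n.+2]exprS invfM mulrAC mulVf// mul1r.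
set s := a * b * c * d in s1 *.
have S0 m : 1 - s * q ^+ m != 0 by rewrite subr_neq0_norm// normMX_lt1.
have -> : s * q ^+ n.+1 = s * q ^+ n * q by rewrite exprSr mulrA.
rewrite qpoch_shift// (qpochS (s * q ^+ n)).
have -> : s * q ^+ n * q ^+ k.+1 = s * (q ^+ n * q) * q ^+ k.
  by rewrite exprS; ring.
have -> : q ^+ n.+2 = q ^+ n * q * q by rewrite !exprSr.
have T0 := S0 n.
have Q0 := @qpochs4_neq0 a b c d q k q1 a1 b1 c1 d1.
have D0 := @aw_den_neq0 a b c d q k q1 a1 b1 c1 d1.
have W1 : 1 - s * q ^+ n ^+ 2 * q != 0 by rewrite -exprM -mulrA -exprSr S0.
have W2 : 1 - s * q ^+ n ^+ 2 * q ^+ 2 != 0 by rewrite -exprM -mulrA -exprD S0.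
rewrite [q ^+ k.+1]exprS -mulrA.
move: (aw_prefix _ _ _ _ _ _) (qpochs _ _ _) Q0 (aw_den _ _ _ _ _ _) D0 => P Q Q0 D D0.
move: (1 - s * q ^+ n * q ^+ k) (1 - s * (q ^+ n * q) * q ^+ k) => M1 M2.
move: (1 - s * q ^+ n) T0 (1 - s * _ * q) W1 (1 - s * _ * q ^+ 2) W2 => T T0 W1 W10 W2 W20.
move: (qpoch _ q k) (qpoch _ q k) (1 - (_)^-1) (q ^+ k) => E H e0 J.
move: (1 - a * b * _) (1 - a * c * _) (1 - a * d * _) => Ab Ac Ad.
by field; rewrite a0 D0 Q0 T0 W10 W20.
Qed.

Lemma aw_coef_down n a b c d q k : a != 0 -> q != 0 -> `|q| < 1 ->
  `|a| < 1 -> `|b| < 1 -> `|c| < 1 -> `|d| < 1 ->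
  aw_gamma n a b c d q * aw_coef n a b c d q k.+1
  = aw_coef n.+1 a b c d q k * aw_ratio_down a b c d q (q ^+ n) (q ^+ k).
Proof.
move=> a0 q0 q1 a1 b1 c1 d1; have s1 : `|a * b * c * d| < 1 by rewrite !normM_lt1.
rewrite /aw_coef mulrA aw_prefix_down// /aw_ratio_down.
case: n => [|n].
  rewrite aw_body_eq0// mulr0; case: k => [|[|k]].
  - by rewrite divr1 subrr !(mul0r, mulr0).
  - by rewrite expr0 expr1 mul1r divff// subrr !(mul0r, mulr0).
  - by rewrite aw_body_eq0// mulr0 mul0r.
have q2 : 1 - q ^- n.+2 != 0.
  rewrite subr_eq0 eq_sym invr_eq1 -subr_eq0 -oppr_eq0 opprB exprS.
  by rewrite subr_neq0_norm// normMX_lt1.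
rewrite /aw_body qpochs4S -[n.+2.-1]/(n.+1) -[n.+1.-1]/n.
have qVn : q ^- n.+1 = q ^- n.+2 * q.
  by rewrite [q ^+ n.+2]exprS invfM mulrAC mulVf// mul1r.
rewrite [in qpoch (q ^- n.+1)]qVn (@qpoch_shift _ (q ^- n.+2))// (qpochS (q ^- n.+2)).
set s := a * b * c * d in s1 *.
have S0 m : 1 - s * q ^+ m != 0 by rewrite subr_neq0_norm// normMX_lt1.
have sqn : s * q ^+ n.+1 = s * q ^+ n * q by rewrite exprSr mulrA.
rewrite [in qpoch (s * q ^+ n.+1)]sqn qpoch_shift// (qpochS (s * q ^+ n)).
have -> : 1 - s * q ^+ n.+1 / q = 1 - s * q ^+ n by rewrite sqn mulfK.
have -> : q ^- n.+2 * q ^+ k = q ^+ k / (q ^+ n.+1 * q) by rewrite -exprSr mulrC.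
have -> : q ^- n.+2 * q ^+ k.+1 = q ^+ k / q ^+ n.+1.
  by rewrite !exprS; field; rewrite q0 expf_neq0.
have T0 := S0 n.
have Q0 := @qpochs4_neq0 a b c d q k q1 a1 b1 c1 d1.
have D0 := @aw_den_neq0 a b c d q k q1 a1 b1 c1 d1.
rewrite -exprSr [q ^+ k.+1]exprS.
move: (aw_drop _ _ _ _ _ _) (aw_prefix _ _ _ _ _ _) (qpochs _ _ _) Q0
  (aw_den _ _ _ _ _ _) D0
  => dr P Q Q0 D D0.
move: (1 - s * q ^+ n * q ^+ k) (1 - s * q ^+ n) T0 (1 - q ^- n.+2) q2 => M T T0 e0 e00.
move: (q ^+ k) (1 - q ^+ k / _) (1 - q ^+ k / _) (qpoch _ q k) (qpoch _ q k) => J e1 e2 E H.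
by field; rewrite D0 Q0 T0 e00.
Qed.

End RecurrenceCoefficients.

Section Recurrence.
Variable C : numFieldType.
Implicit Types (a b c d q s u x V J : C).

Lemma aw_coef0_rec n a b c d q : a != 0 -> `|q| < 1 ->
  `|a| < 1 -> `|b| < 1 -> `|c| < 1 -> `|d| < 1 ->
  aw_coef n.+2 a b c d q 0 = (a^-1 + a - aw_beta n a b c d q) * aw_coef n.+1 a b c d q 0
     - aw_gamma n a b c d q * aw_coef n a b c d q 0.
Proof.
move=> a0 q1 a1 b1 c1 d1; have s1 : `|a * b * c * d| < 1 by rewrite !normM_lt1.
have S0 m : 1 - a * b * c * d * q ^+ m != 0 by rewrite subr_neq0_norm// normMX_lt1.
have W1 : 1 - a * b * c * d * q ^+ n ^+ 2 * q != 0 by rewrite -exprM -mulrA -exprSr S0.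
have W2 : 1 - a * b * c * d * q ^+ n ^+ 2 * q ^+ 2 != 0 by rewrite -exprM -mulrA -exprD S0.
rewrite /aw_coef (mulrA (aw_gamma _ _ _ _ _ _)) aw_prefix_up// aw_prefix_down//.
rewrite /aw_body !qpoch0 !qpochs0 expr0 !mulr1 invr1 !mulr1 /aw_beta /aw_rise; cbv zeta.
move: (q ^+ n) W1 W2 (aw_drop _ _ _ _ _ _) (aw_prefix _ _ _ _ _ _) => V W1 W2 D P.
by field; rewrite a0 W1 W2.
Qed.

Lemma aw_formula_wide n N x a b c d q : q != 0 -> (n < N)%N ->
  askey_wilson_formula n x a b c d q
  = \sum_(0 <= k < N) aw_coef n a b c d q k * aw_basis x a q k.
Proof.
move=> q0 nN; rewrite aw_formula_coef [RHS](@big_cat_nat _ _ _ n.+1)//=.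
rewrite [X in _ = _ + X]big_nat [X in _ = _ + X]big1 ?addr0// => k /andP[nk _].
by rewrite aw_coef_eq0// mul0r.
Qed.

Lemma askey_wilson_formula_rec n x a b c d q : a != 0 -> q != 0 -> `|q| < 1 ->
  `|a| < 1 -> `|b| < 1 -> `|c| < 1 -> `|d| < 1 ->
  askey_wilson_formula n.+2 x a b c d q
  = (2 * x - aw_beta n a b c d q) * askey_wilson_formula n.+1 x a b c d q
    - aw_gamma n a b c d q * askey_wilson_formula n x a b c d q.
Proof.
move=> a0 q0 q1 a1 b1 c1 d1.
have Q1 m u : `|u| < 1 -> 1 - u * q ^+ m != 0.
  by move=> ?; rewrite subr_neq0_norm// normMX_lt1.
have qn0 k : q ^+ k != 0 by rewrite expf_neq0.
pose P k := aw_basis x a q k.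
pose L k := (a * q ^+ k)^-1 + a * q ^+ k.
pose w1 k := aw_coef n.+1 a b c d q k.
have xP k : 2 * x * P k = L k * P k - P k.+1 / (a * q ^+ k).
  rewrite /P /L aw_basisS mulnC exprM; field.
  by rewrite a0 qn0.
rewrite mulrBl.
have -> : 2 * x * askey_wilson_formula n.+1 x a b c d q
  = \sum_(0 <= k < n.+3) L k * w1 k * P k
    - \sum_(0 <= k < n.+2) w1 k / (a * q ^+ k) * P k.+1.
  rewrite (@aw_formula_wide _ n.+3)// mulr_sumr.
  under eq_bigr => k _ do rewrite mulrCA xP mulrBr.
  rewrite sumrB; congr (_ - _).
    by apply: eq_bigr => k _; rewrite mulrA (mulrC (L k)).
  rewrite big_nat_recr//= aw_coef_eq0// mul0r addr0.
  by apply: eq_bigr => k _; rewrite mulrCA mulrC (mulrC (w1 k)).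
rewrite !(@aw_formula_wide _ n.+3)//; last by lia.
rewrite !mulr_sumr.
rewrite ![\sum_(0 <= _ < n.+3) _]big_nat_recl//=.
have split0 (A B D A' B' D' E : C) : A + A' - E - (B + B') - (D + D')
   = (A - B - D) + (A' - E - B' - D') by ring.
rewrite split0 -!sumrB; congr (_ + _).
  rewrite aw_coef0_rec// /L /w1 /P expr0 mulr1; ring.
apply: eq_bigr => k _.
rewrite /w1 /P (mulrA (aw_gamma _ _ _ _ _ _)) aw_coef_up// aw_coef_down// aw_coefS//.
have := @aw_ratio_identity _ a b c d q (q ^+ n) (q ^+ k) a0 q0 (qn0 n) (qn0 k).
rewrite -/(aw_beta n a b c d q) -[q * q ^+ k]exprS -/(L k.+1) => h.
have {}h : aw_ratio_up a b c d q (q ^+ n) (q ^+ k) =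
  (L k.+1 - aw_beta n a b c d q) * aw_ratio a b c d q (q ^+ n) (q ^+ k)
   - (a * q ^+ k)^-1 - aw_ratio_down a b c d q (q ^+ n) (q ^+ k).
  rewrite h ?addrK//.
  - by rewrite -exprSr exprS Q1.
  - by rewrite -exprM Q1 ?normM_lt1.
  - by rewrite -exprM -mulrA -exprSr Q1 ?normM_lt1.
  - by rewrite -exprM -mulrA -exprD Q1 ?normM_lt1.
  - by rewrite /aw_den !mulf_neq0 ?Q1 ?normM_lt1.
rewrite h; ring.
Qed.

End Recurrence.

Section ComplexGeometric.
Variable R : realType.
Local Notation C := (cplx R).
Implicit Types (u z w l : C) (e K r B : R).

Definition nm z : R := ComplexField.Normc.normc z.

Lemma nmE z : `|z| = (nm z)%:C%C.
Proof. by []. Qed.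

Lemma nm0 : nm 0 = 0. Proof. exact: ComplexField.Normc.normc0. Qed.
Lemma nm1 : nm 1 = 1. Proof. exact: ComplexField.Normc.normc1. Qed.
Lemma nm_ge0 z : 0 <= nm z. Proof. by case: z => x y; exact: sqrtr_ge0. Qed.
Lemma nmM z w : nm (z * w) = nm z * nm w.
Proof. exact: ComplexField.Normc.normcM. Qed.
Lemma nmV z : nm z^-1 = (nm z)^-1.
Proof. exact: ComplexField.Normc.normcV. Qed.
Lemma nmD z w : nm (z + w) <= nm z + nm w.
Proof. by have := ler_normD z w; rewrite !nmE -rmorphD lecR. Qed.
Lemma nmN z : nm (- z) = nm z.
Proof. by have := normrN z; rewrite !nmE => /(congr1 (@complex.Re R)). Qed.
Lemma nmB z w : nm (z - w) <= nm z + nm w.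
Proof. by rewrite -(nmN w) nmD. Qed.
Lemma nm_distC z w : nm (z - w) = nm (w - z).
Proof. by rewrite -nmN opprB. Qed.
Lemma nmX z n : nm (z ^+ n) = nm z ^+ n.
Proof. by elim: n => [|n IH]; rewrite ?expr0 ?nm1// !exprS nmM IH. Qed.
Lemma nm_eq0 z : (nm z == 0) = (z == 0).
Proof.
by apply/eqP/eqP => [/ComplexField.Normc.eq0_normc|->]//; rewrite nm0.
Qed.
Lemma nm_lt1 z : (`|z| < 1) = (nm z < 1).
Proof. by rewrite nmE -[1]/(1%:C%C) ltcR. Qed.
Lemma lt_nm z w : (`|z| < `|w|) = (nm z < nm w).
Proof. by rewrite !nmE ltcR. Qed.

Lemma cvg_nm (f : nat -> C) l (e : nat -> R) :
  (forall n, nm (l - f n) <= e n) -> e n @[n --> \oo] --> (0 : R) ->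
  f n @[n --> \oo] --> l.
Proof.
move=> fe e0; apply/cvgrPdist_le => eps eps0.
case: eps eps0 => u v; rewrite ltcE/= => /andP[/eqP-> u0].
move/cvgrPdist_le : e0 => /(_ _ u0); apply: filterS => n.
rewrite sub0r normrN => en; rewrite nmE -[(u +i* 0)%C]/(u%:C%C) lecR.
by rewrite (le_trans (fe n))// (le_trans (ler_norm _)).
Qed.

Lemma nm_cvg_le (f : nat -> C) l B :
  (forall n, nm (f n) <= B) -> f n @[n --> \oo] --> l -> nm l <= B.
Proof.
move=> fB fl; rewrite leNgt; apply/negP => Bl.
have eps0 : 0 < ((nm l - B)%:C)%C :> C by rewrite ltcR subr_gt0.
move/cvgrPdist_lt : fl => /(_ _ eps0) [N _ /(_ N (leqnn N))].
rewrite /= nmE ltcR; apply/negP; rewrite -leNgt.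
rewrite lerBlDr (le_trans _ (lerD (lexx _) (fB N)))//.
by rewrite (le_trans _ (nmD _ _))// subrK.
Qed.

Lemma Re_le_nm z : `|complex.Re z| <= nm z.
Proof. by have := normc_ge_Re z; rewrite -[`|z|]/((nm z)%:C%C) lecR. Qed.

Lemma Im_le_nm z : `|complex.Im z| <= nm z.
Proof.
case: z => x y /=; rewrite -sqrtr_sqr /nm /= ler_wsqrtr// lerDr sqr_ge0//.
Qed.

Lemma nm_le_ReIm z : nm z <= `|complex.Re z| + `|complex.Im z|.
Proof.
case: z => x y /=; rewrite /nm /= -[leRHS]ger0_norm ?addr_ge0// -sqrtr_sqr ler_wsqrtr//.
rewrite sqrrD !real_normK ?num_real// addrAC lerDl -mulr_natl.
by rewrite !mulr_ge0.
Qed.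

Lemma series_Re (f : nat -> C) n :
  complex.Re (series f n) = series (fun k => complex.Re (f k)) n.
Proof.
rewrite /series/=; elim: n => [|n IH]; first by rewrite !big_geq.
by rewrite !big_nat_recr//= -IH; case: (\sum_(_ <= _ < _) _) => ? ?; case: (f n).
Qed.

Lemma series_Im (f : nat -> C) n :
  complex.Im (series f n) = series (fun k => complex.Im (f k)) n.
Proof.
rewrite /series/=; elim: n => [|n IH]; first by rewrite !big_geq.
by rewrite !big_nat_recr//= -IH; case: (\sum_(_ <= _ < _) _) => ? ?; case: (f n).
Qed.

Lemma cvg_series_geometric_le (f : nat -> R) K r : 0 <= r < 1 ->
  (forall n, `|f n| <= K * r ^+ n) -> cvgn (series f).
Proof.
move=> /andP[r0 r1] fK; apply: normed_cvg.
apply: (@series_le_cvg _ _ (geometric K r)) => //=.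
- by move=> n; rewrite (le_trans _ (fK n)).
- by apply: is_cvg_geometric_series; rewrite ger0_norm.
Qed.

Lemma geometric_tail (f : nat -> C) K r n m : 0 <= r < 1 ->
  (forall n, nm (f n) <= K * r ^+ n) ->
  nm (series f (n + m)%N - series f n) <= K / (1 - r) * r ^+ n.
Proof.
move=> /andP[r0 r1] fK.
have K0 : 0 <= K by have := fK 0%N; rewrite mulr1; apply: le_trans (nm_ge0 _).
have s0 : 0 < 1 - r by rewrite subr_gt0.
suff : nm (series f (n + m)%N - series f n) <= K / (1 - r) * r ^+ n * (1 - r ^+ m).
  move/le_trans; apply; rewrite ler_piMr ?lerBlDr ?lerDl ?exprn_ge0//.
  by rewrite !mulr_ge0 ?invr_ge0 ?exprn_ge0// ltW.
elim: m => [|m IH]; first by rewrite addn0 subrr nm0 expr0 subrr mulr0.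
rewrite addnS [series f _.+1]seriesSr addrAC.
rewrite (le_trans (nmD _ _))// (le_trans (lerD IH (fK _)))//.
rewrite exprD exprS le_eqVlt; apply/orP; left; apply/eqP; field.
by rewrite gt_eqF.
Qed.

Lemma cvg_geometric_bound (f : nat -> C) K r : 0 <= r < 1 ->
  (forall n, nm (f n) <= K * r ^+ n) ->
  exists2 l, series f n @[n --> \oo] --> l &
    forall n, nm (l - series f n) <= K / (1 - r) * r ^+ n.
Proof.
move=> r01 fK.
have cRe : cvgn (series (fun k => complex.Re (f k))).
  by apply: cvg_series_geometric_le r01 _ => n; exact: le_trans (Re_le_nm _) (fK n).
have cIm : cvgn (series (fun k => complex.Im (f k))).
  by apply: cvg_series_geometric_le r01 _ => n; exact: le_trans (Im_le_nm _) (fK n).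
set lr := limn _ in cRe; set li := limn _ in cIm.
have cl : series f n @[n --> \oo] --> ((lr +i* li)%C : C).
  apply: (@cvg_nm _ _ (fun n => `|lr - series (fun k => complex.Re (f k)) n|
      + `|li - series (fun k => complex.Im (f k)) n|)).
    move=> n; rewrite -series_Re -series_Im; apply: le_trans (nm_le_ReIm _) _.
    by case: (series f n).
  rewrite -[X in _ --> X]addr0; apply: cvgD.
    rewrite -(normr0 R) -(subrr lr); apply: cvg_norm; apply: cvgB => //; exact: cvg_cst.
  rewrite -(normr0 R) -(subrr li); apply: cvg_norm; apply: cvgB => //; exact: cvg_cst.
exists (lr +i* li)%C => // n.
apply: (@nm_cvg_le (fun m => series f (n + m)%N - series f n)).
  by move=> m; exact: geometric_tail.
apply: cvgB; last exact: cvg_cst.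
rewrite (_ : (fun m => _) = (fun m => series f (m + n)%N)) ?cvg_shiftn//.
by apply/funext => m; rewrite addnC.
Qed.

End ComplexGeometric.

Section InfiniteProducts.
Variable R : realType.
Local Notation C := (cplx R).
Implicit Types (F : nat -> C) (a q u x P : C) (K r B : R).

Lemma cvg_prod_geometric F K r : 0 <= r < 1 ->
  (forall n, nm (F n - 1) <= K * r ^+ n) ->
  exists P B, [/\ 0 <= B, (\prod_(0 <= k < n) F k) @[n --> \oo] --> P &
    forall n, nm (P - \prod_(0 <= k < n) F k) <= B * r ^+ n].
Proof.
move=> r01 FK; have /andP[r0 r1] := r01.
have K0 : 0 <= K by have := FK 0%N; rewrite mulr1; apply: le_trans (nm_ge0 _).
have s0 : 0 < 1 - r by rewrite subr_gt0.
pose p n := \prod_(0 <= k < n) F k.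
have pS n : p n.+1 = p n * F n by rewrite /p big_nat_recr.
have pbound n : nm (p n) <= expR (K * (1 - r ^+ n) / (1 - r)).
  elim: n => [|n IH].
    by rewrite /p big_geq// nm1 expr0 subrr mulr0 mul0r expR0.
  have -> : K * (1 - r ^+ n.+1) / (1 - r) = K * (1 - r ^+ n) / (1 - r) + K * r ^+ n.
    by rewrite exprS; field; rewrite gt_eqF.
  rewrite pS nmM expRD ler_pM ?nm_ge0// (le_trans _ (expR_ge1Dx _))//.
  have -> : F n = 1 + (F n - 1) by rewrite addrC subrK.
  by rewrite (le_trans (nmD _ _))// nm1 lerD2l.
pose M := expR (K / (1 - r)).
have {}pbound n : nm (p n) <= M.
  rewrite (le_trans (pbound n))// ler_expR ler_pM2r ?invr_gt0//.
  by rewrite ler_piMr// lerBlDr lerDl exprn_ge0.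
have [n|l cl ltail] := @cvg_geometric_bound R (fun n => p n.+1 - p n) (M * K) r r01.
  rewrite pS -[X in _ - X]mulr1 -mulrBr nmM -mulrA.
  by rewrite ler_pM ?nm_ge0.
have tel n : series (fun n => p n.+1 - p n) n = p n - 1.
  by rewrite /series/= telescope_sumr// /p [X in _ - X]big_geq.
exists (l + 1), (M * K / (1 - r)); split.
- by rewrite !mulr_ge0 ?invr_ge0 ?expR_ge0 ?(ltW s0).
- have -> : (fun n => \prod_(0 <= k < n) F k)
      = (fun n => series (fun n => p n.+1 - p n) n + 1).
    by apply/funext => n; rewrite tel subrK.
  exact: cvgD cl (cvg_cst _).
- move=> n; have := ltail n; rewrite tel opprB addrA; exact.
Qed.

Lemma nm_lower_bound F N : (forall n, F n != 0) ->
  exists2 e : R, 0 < e & forall n, (n < N)%N -> e <= nm (F n).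
Proof.
move=> F0; elim: N => [|N [e e0 IH]]; first by exists 1.
exists (Num.min e (nm (F N))).
  by rewrite lt_min e0 lt_neqAle eq_sym nm_eq0 F0 nm_ge0.
move=> n; rewrite ltnS leq_eqVlt => /orP[/eqP->|/IH en].
  by rewrite ge_min lexx orbT.
by rewrite ge_min en.
Qed.

Lemma prod_geometric_neq0 F K r P : 0 <= r < 1 ->
  (forall n, nm (F n - 1) <= K * r ^+ n) -> (forall n, F n != 0) ->
  (\prod_(0 <= k < n) F k) @[n --> \oo] --> P -> P != 0.
Proof.
move=> r01 FK F0 FP; have /andP[r0 r1] := r01.
have K0 : 0 <= K by have := FK 0%N; rewrite mulr1; apply: le_trans (nm_ge0 _).
have : K * r ^+ n @[n --> \oo] --> (0 : R).
  by apply: cvg_geometric; rewrite ger0_norm.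
move/cvgrPdist_le => /(_ (1 / 2))[|N _ HN]; first by rewrite divr_gt0.
have [e e0 He] := nm_lower_bound N F0.
pose e' := Num.min e (1 / 2).
have e'0 : 0 < e' by rewrite lt_min e0/= divr_gt0.
have Fe n : e' <= nm (F n).
  case: (ltnP n N) => [/He|/HN]; first by move=> ?; rewrite ge_min; apply/orP; left.
  rewrite /= sub0r normrN => h; rewrite ge_min; apply/orP; right.
  have h1 := le_trans (FK n) (le_trans (ler_norm _) h).
  have := nmD (1 - F n) (F n); rewrite subrK nm1 nm_distC; lra.
have GK n : nm ((F n)^-1 - 1) <= (K / e') * r ^+ n.
  have -> : (F n)^-1 - 1 = - (F n - 1) * (F n)^-1.
    by rewrite opprB mulrBl mul1r divff.
  rewrite nmM nmN nmV mulrAC ler_pM ?nm_ge0 ?invr_ge0 ?nm_ge0// lef_pV2// posrE//.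
  exact: lt_le_trans (Fe n).
have [Q [B [_ GQ _]]] := cvg_prod_geometric r01 GK.
have inv_prod n : (\prod_(0 <= k < n) F k) * (\prod_(0 <= k < n) (F k)^-1) = 1.
  by rewrite prodfV divff// prodf_seq_neq0; apply/allP => k _; apply/implyP.
have c1 : (\prod_(0 <= k < n) F k) * (\prod_(0 <= k < n) (F k)^-1)
    @[n --> \oo] --> (1 : C).
  by apply: cvg_near_cst; apply: nearW => n; rewrite inv_prod.
have PQ := cvg_unique (@norm_hausdorff _ _) c1 (cvgM FP GQ).
by apply: contraTneq (oner_neq0 C) => P0; rewrite PQ P0 mul0r eqxx.
Qed.

Lemma qpoch_factor_bound u q n : nm (1 - u * q ^+ n - 1) <= nm u * nm q ^+ n.
Proof. by rewrite addrAC subrr sub0r nmN nmM nmX. Qed.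

Lemma nm01 q : `|q| < 1 -> 0 <= nm q < 1.
Proof. by rewrite nm_lt1 nm_ge0. Qed.

Lemma infprod_lim F P : (\prod_(0 <= k < n) F k) @[n --> \oo] --> P -> infprod F = P.
Proof. by move=> FP; apply: cvg_lim => //; exact: norm_hausdorff. Qed.

Lemma cvg_qpoch u q : `|q| < 1 -> qpoch u q n @[n --> \oo] --> qpochoo u q.
Proof.
move=> q1.
have [P [B [_ FP _]]] := cvg_prod_geometric (nm01 q1) (qpoch_factor_bound u q).
by rewrite /qpochoo (infprod_lim FP).
Qed.

Lemma qpochoo_neq0 u q : `|u| < 1 -> `|q| < 1 -> qpochoo u q != 0.
Proof.
move=> u1 q1.
apply: (@prod_geometric_neq0 (fun n => 1 - u * q ^+ n) _ _ _ (nm01 q1)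
  (qpoch_factor_bound u q) _ (@cvg_qpoch u q q1)).
by move=> n; rewrite subr_neq0_norm// normMX_lt1.
Qed.

Lemma aw_factor_bound x a q n : `|q| < 1 ->
  nm (1 - 2 * a * x * q ^+ n + a ^+ 2 * q ^+ (2 * n) - 1)
    <= (nm (2 * a * x) + nm (a ^+ 2)) * nm q ^+ n.
Proof.
move=> q1; have /andP[r0 r1] := nm01 q1.
rewrite (_ : _ - 1 = a ^+ 2 * q ^+ (2 * n) - 2 * a * x * q ^+ n); last by ring.
have h : nm q ^+ (2 * n) <= nm q ^+ n.
  by rewrite ler_wiXn2l ?(ltW r1)//; lia.
rewrite (le_trans (nmB _ _))// [nm (a ^+ 2 * _)]nmM [nm (_ * q ^+ n)]nmM.
by rewrite (nmX q n) (nmX q (2 * n)) [leRHS]mulrDl addrC lerD// ler_wpM2l ?nm_ge0.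
Qed.

Lemma phi_h_factor x a q n : 1 - 2 * x * a * q ^+ n + a ^+ 2 * q ^+ (2 * n)
  = 1 - 2 * a * x * q ^+ n + a ^+ 2 * q ^+ (2 * n).
Proof. by ring. Qed.

(* Also valid at a pole of phi_h, where both sides are 0. *)
Lemma cvg_aw_basis x a q : `|q| < 1 ->
  aw_basis x a q n @[n --> \oo] --> (phi_h x a q)^-1.
Proof.
move=> q1.
pose F n := 1 - 2 * a * x * q ^+ n + a ^+ 2 * q ^+ (2 * n).
have FK n := aw_factor_bound x a n q1.
have [P [B [_ FP _]]] := cvg_prod_geometric (nm01 q1) FK.
suff -> : (phi_h x a q)^-1 = P by [].
have [F0|/existsNP[N /negP/negPn/eqP FN]] := pselect (forall n, F n != 0).
  have P0 : P != 0 by exact: prod_geometric_neq0 (nm01 q1) FK F0 FP.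
  apply: (canLR invrK); apply: infprod_lim.
  under eq_fun do under eq_bigr do rewrite phi_h_factor.
  under eq_fun do rewrite prodfV.
  exact: cvgV.
have Z n : (N < n)%N -> \prod_(0 <= k < n) F k = 0.
  move=> Nn; apply/eqP; rewrite prodf_seq_eq0; apply/hasP; exists N.
    by rewrite mem_index_iota.
  by rewrite /= FN.
have cst0 (G : nat -> C) (L : C) :
    (forall n, (N < n)%N -> G n = 0) -> G n @[n --> \oo] --> L -> L = 0.
  move=> G0 GL; apply: (cvg_unique (@norm_hausdorff _ _) GL).
  by apply: cvg_near_cst; exists N.+1.
rewrite (cst0 _ _ Z FP).
suff -> : phi_h x a q = 0 by rewrite invr0.
apply: infprod_lim; apply: cvg_near_cst; exists N.+1 => // n /= Nn.
under eq_bigr do rewrite phi_h_factor.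
by rewrite prodfV Z// invr0.
Qed.

End InfiniteProducts.

Section Toeplitz.
Variable R : realType.
Local Notation C := (cplx R).
Implicit Types (a b c d q u x : C) (K r B : R).

Lemma cvg_nm_dist (f : nat -> C) l :
  f n @[n --> \oo] --> l -> nm (f n - l) @[n --> \oo] --> (0 : R).
Proof.
move=> fl; apply/cvgrPdist_lt => e e0.
have eps0 : 0 < (e%:C)%C :> C by rewrite ltcR.
move/cvgrPdist_lt : fl => /(_ _ eps0); apply: filterS => n.
by rewrite nmE ltcR sub0r normrN ger0_norm ?nm_ge0// nm_distC.
Qed.

Lemma cvg_geometric_convolution (e : nat -> R) r : 0 <= r < 1 ->
  (forall n, 0 <= e n) -> e n @[n --> \oo] --> (0 : R) ->
  \sum_(0 <= k < n.+1) r ^+ (n - k) * e k @[n --> \oo] --> (0 : R).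
Proof.
move=> /andP[r0 r1] e0 ce; have s0 : 0 < 1 - r by rewrite subr_gt0.
pose y n := \sum_(0 <= k < n.+1) r ^+ (n - k) * e k.
have y0 n : 0 <= y n by apply: sumr_ge0 => k _; rewrite mulr_ge0// exprn_ge0.
have yS n : y n.+1 = r * y n + e n.+1.
  rewrite /y big_nat_recr//= subnn expr0 mul1r mulr_sumr; congr (_ + _).
  by apply: eq_big_nat => k /andP[_ kn]; rewrite subSn// exprS mulrA.
apply/cvgrPdist_le => eps eps0.
have eta0 : 0 < eps / 2 * (1 - r) by rewrite mulr_gt0// divr_gt0.
move/cvgrPdist_le : ce => /(_ _ eta0) [N _ HN].
have yN m : y (N + m)%N <= r ^+ m * y N + eps / 2.
  elim: m => [|m IH]; first by rewrite addn0 expr0 mul1r lerDl divr_ge0// ltW.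
  have := HN (N + m.+1)%N (leq_addr _ _); rewrite /= sub0r normrN => h.
  have {}h := le_trans (ler_norm _) h.
  rewrite addnS yS -addnS exprS.
  have := ler_wpM2l r0 IH; nra.
have : r ^+ m * y N @[m --> \oo] --> (0 : R).
  rewrite -(mul0r (y N)); apply: cvgM; last exact: cvg_cst.
  by apply: cvg_expr; rewrite ger0_norm.
move/cvgrPdist_le => /(_ (eps / 2))[|M _ HM]; first by rewrite divr_gt0.
exists (N + M)%N => // n /= Nn.
rewrite -/(y n) sub0r normrN ger0_norm//.
have -> : n = (N + (n - N))%N by lia.
have : (M <= n - N)%N by lia.
move=> /HM /=; rewrite sub0r normrN => h.
have {}h := le_trans (ler_norm _) h.
have := yN (n - N)%N; lra.
Qed.

Lemma nm_lower_bound_lim (f : nat -> C) P : (forall n, f n != 0) ->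
  f n @[n --> \oo] --> P -> P != 0 ->
  exists2 e : R, 0 < e & forall n, e <= nm (f n).
Proof.
move=> f0 fP P0.
have p0 : 0 < nm P by rewrite lt_neqAle eq_sym nm_eq0 P0 nm_ge0.
have /cvgrPdist_le := cvg_nm_dist fP.
move=> /(_ (nm P / 2))[|N _ HN]; first by rewrite divr_gt0.
have [e e0 He] := nm_lower_bound N f0.
exists (Num.min e (nm P / 2)) => [|n]; first by rewrite lt_min e0/= divr_gt0.
rewrite ge_min; case: (ltnP n N) => [/He ->//|/HN/=].
rewrite sub0r normrN ger0_norm ?nm_ge0// => h; apply/orP; right.
have := nmB (f n) (f n - P); rewrite opprB addrC subrK; lra.
Qed.

Lemma qpoch_lower_bound (m r : R) : 0 <= m < 1 -> 0 <= r < 1 ->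
  exists2 e : R, 0 < e &
    forall u q n, nm u <= m -> nm q <= r -> e <= nm (qpoch u q n).
Proof.
move=> /andP[m0 m1] /andP[r0 r1].
have nmR (t : R) : 0 <= t -> nm (t%:C%C) = t.
  by move=> t0; rewrite /nm /= expr0n/= addr0 sqrtr_sqr ger0_norm.
pose M : C := (m%:C)%C; pose Q : C := (r%:C)%C.
have M1 : `|M| < 1 by rewrite nm_lt1 nmR.
have Q1 : `|Q| < 1 by rewrite nm_lt1 nmR.
have [e e0 He] := nm_lower_bound_lim (fun n => qpoch_neq0 n M1 Q1) (@cvg_qpoch _ M Q Q1)
  (qpochoo_neq0 M1 Q1).
exists e => // u q n um qr; apply: le_trans (He n) _.
elim: n => [|n IH]; first by rewrite !qpoch0.
rewrite !qpochS !nmM ler_pM ?nm_ge0//.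
have mr : m * r ^+ n < 1.
  by rewrite (le_lt_trans _ m1)// ler_piMr// exprn_ile1// ltW.
have -> : 1 - M * Q ^+ n = ((1 - m * r ^+ n)%:C)%C.
  by rewrite rmorphB rmorphM rmorphXn.
rewrite nmR ?subr_ge0 ?(ltW mr)//.
have uq : nm (u * q ^+ n) <= m * r ^+ n.
  by rewrite nmM nmX ler_pM ?nm_ge0 ?exprn_ge0 ?nm_ge0// lerXn2r// nnegrE nm_ge0.
have := nmD (1 - u * q ^+ n) (u * q ^+ n); rewrite subrK nm1; lra.
Qed.

Lemma euler_coef_bound q : `|q| < 1 ->
  exists2 K : R, 0 <= K & forall m n, nm (euler_coef q m / qpoch q q n) <= K * nm q ^+ m.
Proof.
move=> q1; have /andP[r0 r1] := nm01 q1.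
have [e e0 He] := qpoch_lower_bound (nm01 q1) (nm01 q1).
exists (e^-1 * e^-1) => [|m n]; first by rewrite mulr_ge0// invr_ge0 ltW.
have h k : nm (qpoch q q k)^-1 <= e^-1.
  by rewrite nmV lef_pV2 ?posrE ?He// (lt_le_trans e0 (He _ _ _ _ _)).
have hq : nm q ^+ 'C(m.+1, 2) <= nm q ^+ m.
  by rewrite ler_wiXn2l ?(ltW r1)// binS bin1; lia.
rewrite /euler_coef !nmM !nmX nmN nm1 expr1n mul1r -mulrA mulrC.
by rewrite ler_pM ?mulr_ge0 ?nm_ge0 ?exprn_ge0 ?nm_ge0// ler_pM ?nm_ge0.
Qed.

Lemma sum_euler_coef q N : `|q| < 1 ->
  \sum_(0 <= k < N.+1) euler_coef q (N - k) / qpoch q q k = 1.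
Proof.
move=> q1; have := qbinomial_invsum q N q1.
rewrite divff ?qpoch_neq0// => <-.
rewrite [RHS]big_nat_rev/=; apply: eq_big_nat => k /andP[_ kN].
rewrite add0n subSS subKn // /euler_coef binS bin1 exprD (exprNn q) invfM.
by ring.
Qed.

Lemma qpochsoo3 (u v w q : C) :
  qpochsoo [:: u; v; w] q = qpochoo u q * qpochoo v q * qpochoo w q.
Proof.
rewrite /qpochsoo; move: (@qpochoo C) => f.
by rewrite !big_cons big_nil mulr1 mulrA.
Qed.

Lemma div_prod3 (F : fieldType) (p u v w h : F) :
  p / (u * v * w * h) = p * (h^-1 / (u * v * w)).
Proof. by rewrite -invfM [h * _]mulrC. Qed.

Lemma cvg_basis_ratio x a b c d q :
  `|a| < 1 -> `|b| < 1 -> `|c| < 1 -> `|d| < 1 -> `|q| < 1 ->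
  aw_basis x a q n / (qpoch (a * b) q n * qpoch (a * c) q n * qpoch (a * d) q n)
    @[n --> \oo]
  --> (phi_h x a q)^-1 / (qpochoo (a * b) q * qpochoo (a * c) q * qpochoo (a * d) q).
Proof.
move=> a1 b1 c1 d1 q1; apply: cvgM; first exact: cvg_aw_basis.
apply: cvgV; first by rewrite !mulf_neq0// qpochoo_neq0 ?normM_lt1.
by apply: cvgM; [apply: cvgM|]; exact: cvg_qpoch.
Qed.

Lemma inverse_expansion_cvg x a b c d q :
  a != 0 -> q != 0 -> `|q| < 1 -> `|a| < 1 -> `|b| < 1 -> `|c| < 1 -> `|d| < 1 ->
  series (fun n : nat =>
        (- a) ^+ n * q ^+ 'C(n, 2)
        * (qpoch (a * b * c * d) q (2 * n)
           / qpochs [:: a * b; a * c; a * d; q] q n)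
        * askey_wilson_formula n x a b c d q)
      @ \oo -->
      qpochoo (a * b * c * d) q
      / (qpochsoo [:: a * b; a * c; a * d] q * phi_h x a q).
Proof.
move=> a0 q0 q1 a1 b1 c1 d1.
rewrite -cvg_shiftS/= /series/=.
under eq_fun do rewrite inverse_expansion_partial//.
set s := a * b * c * d; set L := _ / _.
have Q0 n : qpoch q q n != 0 by rewrite qpoch_neq0.
pose f n := aw_basis x a q n
  / (qpoch (a * b) q n * qpoch (a * c) q n * qpoch (a * d) q n).
pose fl := (phi_h x a q)^-1
  / (qpochoo (a * b) q * qpochoo (a * c) q * qpochoo (a * d) q).
have cf : f n @[n --> \oo] --> fl by exact: cvg_basis_ratio.
have LE : L = qpochoo s q * fl.
  by rewrite /L qpochsoo3; exact: div_prod3.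
have [P [B [B0 sP sB]]] := cvg_prod_geometric (nm01 q1) (qpoch_factor_bound s q).
rewrite -(infprod_lim sP) -/(qpochoo s q) in sB.
have sM n : nm (qpoch s q n) <= nm (qpochoo s q) + B.
  have := nmB (qpochoo s q) (qpochoo s q - qpoch s q n).
  rewrite opprB addrC subrK => h; apply: (le_trans h); rewrite lerD2l.
  apply: le_trans (sB n) _; rewrite ler_piMr//.
  by have /andP[? ?] := nm01 q1; rewrite exprn_ile1// ltW.
pose M := nm (qpochoo s q) + B.
pose e n := M * nm (f n - fl) + nm fl * (B * nm q ^+ n).
have e0 n : 0 <= e n.
  by rewrite /e /M !(addr_ge0, mulr_ge0) ?exprn_ge0 ?nm_ge0.
have ce : e n @[n --> \oo] --> (0 : R).
  have cr : nm q ^+ n @[n --> \oo] --> (0 : R).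
    by apply: cvg_expr; rewrite ger0_norm ?nm_ge0//; have /andP[] := nm01 q1.
  have <- : M * 0 + nm fl * (B * 0) = 0 by rewrite !mulr0 addr0.
  apply: cvgD; apply: cvgM; [exact: cvg_cst|exact: (cvg_nm_dist cf)|exact: cvg_cst|].
  by apply: cvgM => //; exact: cvg_cst.
have [K K0 eK] := euler_coef_bound q1.
have ct : K * \sum_(0 <= k < n.+1) nm q ^+ (n - k) * e k @[n --> \oo] --> (0 : R).
  rewrite -[X in _ --> X](mulr0 K).
  apply: cvgM; first exact: cvg_cst.
  exact: (cvg_geometric_convolution (nm01 q1) e0 ce).
apply: (@cvg_nm _ _ L _ _ ct).
move=> n; rewrite nm_distC -[L]mul1r -(sum_euler_coef n q1) mulr_suml -sumrB.
have nm_sum (F : nat -> C) m : nm (\sum_(0 <= k < m) F k) <= \sum_(0 <= k < m) nm (F k).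
  elim: m => [|m IH]; first by rewrite !big_geq// nm0.
  by rewrite !big_nat_recr//= (le_trans (nmD _ _))// lerD2r.
apply: le_trans (nm_sum _ _) _; rewrite mulr_sumr; apply: ler_sum => k _.
rewrite [X in nm X](_ : _ = euler_coef q (n - k) / qpoch q q k
   * (qpoch s q (n + k) * (f k - fl)
   - fl * (qpochoo s q - qpoch s q (n + k)))); last first.
  rewrite /f LE !qpochsE; field.
  by rewrite Q0 !qpoch_neq0 ?normM_lt1.
rewrite nmM mulrA ler_pM ?nm_ge0//.
rewrite (le_trans (nmB _ _))// (nmM (qpoch s q _)) (nmM fl) lerD//.
  by rewrite ler_wpM2r ?nm_ge0 ?sM.
rewrite ler_wpM2l ?nm_ge0// (le_trans (sB _))// ler_wpM2l// ler_wiXn2l ?nm_ge0//.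
  by have /andP[_ /ltW] := nm01 q1.
by rewrite leq_addl.
Qed.

End Toeplitz.

Section RemovableSingularities.
Variable C : numFieldType.
Implicit Types (a b c d q x : C).

Definition punctured : set (C * C) := [set p | p.1 != 0 /\ p.2 != 0].

Lemma nbhs_nonzero a (A : set C) : nbhs a A -> exists2 u, A u & u != 0.
Proof.
have [->|a0 Aa] := eqVneq a 0; last by exists a => //; exact: nbhs_singleton.
move=> /nbhs_dnbhs A0.
have : (0 : C)^' (A `&` [set u | u != 0]).
  by apply: filterI => //; exact: withinT.
by move=> /filter_ex [u [Au u0]]; exists u.
Qed.

Lemma punctured_proper a q : ProperFilter (within punctured (nbhs (a, q))).
Proof.
apply: within_nbhs_proper => B [[B1 B2] [/= aB1 qB2] sB].
have [u B1u u0] := nbhs_nonzero aB1.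
have [v B2v v0] := nbhs_nonzero qB2.
by exists (u, v); split => //; exact: sB.
Qed.

Lemma punctured_fst a q : p.1 @[p --> within punctured (nbhs (a, q))] --> a.
Proof. by apply: cvg_within_filter; exact: cvg_fst. Qed.

Lemma punctured_snd a q : p.2 @[p --> within punctured (nbhs (a, q))] --> q.
Proof. by apply: cvg_within_filter; exact: cvg_snd. Qed.

Lemma near_punctured a q : `|a| < 1 -> `|q| < 1 ->
  \forall p \near within punctured (nbhs (a, q)),
    [/\ p.1 != 0, p.2 != 0, `|p.1| < 1 & `|p.2| < 1].
Proof.
move=> a1 q1; have F := punctured_proper a q.
have A : within punctured (nbhs (a, q)) punctured by exact: withinT.
have A1 := cvgr_norm_lt _ (@punctured_fst a q) _ a1.
have A2 := cvgr_norm_lt _ (@punctured_snd a q) _ q1.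
apply: filterS (filterI A (filterI (A1 _) (A2 _))) => p.
by move=> [[p1 p2] [n1 n2]]; split.
Qed.

Lemma askey_wilson_cvg n x a b c d q l : ~~ ((a != 0) && (q != 0)) ->
  askey_wilson_formula n x p.1 b c d p.2
    @[p --> within punctured (nbhs (a, q))] --> l ->
  askey_wilson n x a b c d q = l.
Proof.
move=> /negbTE aq fl; rewrite /askey_wilson aq.
have F := punctured_proper a q.
by apply: cvg_lim => //; exact: norm_hausdorff.
Qed.

Lemma cvg_exprn (T : Type) (F : set_system T) (FF : Filter F) (f : T -> C) (l : C) n :
  f t @[t --> F] --> l -> f t ^+ n @[t --> F] --> l ^+ n.
Proof.
move=> fl; elim: n => [|n IH].
  have -> : (fun t => f t ^+ 0) = (fun=> 1) by apply/funext => t; rewrite expr0.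
  by rewrite expr0; exact: cvg_cst.
have -> : (fun t => f t ^+ n.+1) = (fun t => f t * f t ^+ n).
  by apply/funext => t; rewrite exprS.
by rewrite exprS; exact: cvgM fl IH.
Qed.

Section Rules.
Variables (T : Type) (F : set_system T) (FF : Filter F) (f g : T -> C) (l m : C).
Hypotheses (fl : f t @[t --> F] --> l) (gm : g t @[t --> F] --> m).

Lemma cvg_fun_add : (fun t => f t + g t) @ F --> l + m.
Proof. exact: cvgD. Qed.

Lemma cvg_fun_opp : (fun t => - f t) @ F --> - l.
Proof. exact: cvgN. Qed.

Lemma cvg_fun_mul : (fun t => f t * g t) @ F --> l * m.
Proof. exact: cvgM. Qed.

Lemma cvg_fun_inv : l != 0 -> (fun t => (f t)^-1) @ F --> l^-1.
Proof. by move=> l0; exact: cvgV. Qed.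

End Rules.

Ltac cvg_rational := lazymatch goal with
  | |- (_ --> (_ + _)) => refine (cvg_fun_add _ _ _); cvg_rational
  | |- (_ --> (- _)) => refine (cvg_fun_opp _ _); cvg_rational
  | |- (_ --> (_ * _)) => refine (cvg_fun_mul _ _ _); cvg_rational
  | |- (_ --> (_ ^+ _)) => refine (@cvg_exprn _ _ _ _ _ _ _); cvg_rational
  | |- (_ --> (_^-1)) => refine (cvg_fun_inv _ _ _); cvg_rational
  | |- (?G --> _) => lazymatch G with
     | context [fun _ => fst _] => refine (@punctured_fst _ _)
     | context [fun _ => snd _] => refine (@punctured_snd _ _)
     | _ => refine (cvg_cst _)
     end
  | |- _ => idtac
  end.

Lemma subr_neq0_normMX u q n : `|u| < 1 -> `|q| < 1 -> 1 - u * q ^+ n != 0.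
Proof. by move=> u1 q1; rewrite subr_neq0_norm// normMX_lt1. Qed.

Lemma cvg_aw_beta m a b c d q : `|q| < 1 -> `|a * b * c * d| < 1 ->
  aw_beta m p.1 b c d p.2 @[p --> within punctured (nbhs (a, q))]
    --> aw_beta m a b c d q.
Proof.
move=> q1 s1; rewrite /aw_beta /aw_rise /aw_drop; cbv zeta.
cvg_rational; rewrite mulf_neq0// -exprM -?mulrA -?exprSr -?exprD ?mulrA.
all: by rewrite subr_neq0_normMX.
Qed.

Lemma cvg_aw_gamma m a b c d q : `|q| < 1 -> `|a * b * c * d| < 1 ->
  aw_gamma m p.1 b c d p.2 @[p --> within punctured (nbhs (a, q))]
    --> aw_gamma m a b c d q.
Proof.
move=> q1 s1; rewrite /aw_gamma /aw_drop.
cvg_rational; rewrite ?mulf_neq0// -?exprM -?mulrA -?exprSr -?exprD ?mulrA.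
all: by rewrite subr_neq0_normMX.
Qed.

Definition aw_first x a b c d : C :=
  (2 * x - (b + c + d) + b * c * d + a * (b * c + b * d + c * d) - a
   - 2 * a * (b * c * d) * x) / (1 - a * b * c * d).

Fixpoint aw_rec x a b c d q n : C :=
  match n with
  | 0%N => 1
  | n'.+1 =>
    match n' with
    | 0%N => aw_first x a b c d
    | m.+1 => (2 * x - aw_beta m a b c d q) * aw_rec x a b c d q n'
              - aw_gamma m a b c d q * aw_rec x a b c d q m
    end
  end.

Lemma aw_recS x a b c d q n : aw_rec x a b c d q n.+2 =
  (2 * x - aw_beta n a b c d q) * aw_rec x a b c d q n.+1
  - aw_gamma n a b c d q * aw_rec x a b c d q n.
Proof. by []. Qed.

Lemma aw_formula_rec x a b c d q n : a != 0 -> q != 0 -> `|q| < 1 ->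
  `|a| < 1 -> `|b| < 1 -> `|c| < 1 -> `|d| < 1 ->
  askey_wilson_formula n x a b c d q = aw_rec x a b c d q n.
Proof.
move=> a0 q0 q1 a1 b1 c1 d1.
suff : askey_wilson_formula n x a b c d q = aw_rec x a b c d q n
  /\ askey_wilson_formula n.+1 x a b c d q = aw_rec x a b c d q n.+1 by case.
elim: n => [|n [IH0 IH1]]; last first.
  by split => //; rewrite aw_recS askey_wilson_formula_rec// IH0 IH1.
have Q m u : `|u| < 1 -> 1 - u * q ^+ m != 0 by move=> ?; exact: subr_neq0_normMX.
split.
  rewrite /askey_wilson_formula !qpochs0 big_nat1 !qpoch0 qpochs0 big_geq//.
  by rewrite /= !expr0 !(mul1r, mulr1, invr1).
rewrite /askey_wilson_formula big_nat_recr//= big_nat1 big_nat1 big_geq// !qpochs0 !qpoch0.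
rewrite !qpochsE !qpoch1 ?muln0 ?expr0 ?expr1 ?mulr1 /aw_first.
have := (Q 0%N (a * b * c * d), Q 0%N (a * b), Q 0%N (a * c), Q 0%N (a * d), Q 0%N q).
rewrite !expr0 !mulr1 => -[[[[Qs Qb] Qc] Qd] Qq].
by field; rewrite a0 q0 Qs ?Qb ?Qc ?Qd ?Qq ?normM_lt1.
Qed.

Lemma cvg_aw_rec x a b c d q n : `|q| < 1 -> `|a * b * c * d| < 1 ->
  aw_rec x p.1 b c d p.2 n @[p --> within punctured (nbhs (a, q))]
    --> aw_rec x a b c d q n.
Proof.
move=> q1 s1.
suff : (aw_rec x p.1 b c d p.2 n @[p --> within punctured (nbhs (a, q))]
    --> aw_rec x a b c d q n) /\
  (aw_rec x p.1 b c d p.2 n.+1 @[p --> within punctured (nbhs (a, q))]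
    --> aw_rec x a b c d q n.+1) by case.
elim: n => [|n [IH0 IH1]].
  split => /=; first exact: cvg_cst.
  rewrite /aw_first; cvg_rational.
  by rewrite subr_neq0_norm.
split => //; rewrite aw_recS; under eq_fun do rewrite aw_recS.
have cb := @cvg_aw_beta n a b c d q q1 s1.
have cg := @cvg_aw_gamma n a b c d q q1 s1.
refine (cvg_fun_add _ (cvg_fun_mul _ (cvg_fun_add _ (cvg_cst _) _) IH1) _).
  exact: (cvg_fun_opp _ cb).
exact: (cvg_fun_opp _ (cvg_fun_mul _ cg IH0)).
Qed.

Lemma askey_wilsonE n x a b c d q : `|q| < 1 ->
  `|a| < 1 -> `|b| < 1 -> `|c| < 1 -> `|d| < 1 ->
  askey_wilson n x a b c d q = aw_rec x a b c d q n.
Proof.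
move=> q1 a1 b1 c1 d1.
case aq : ((a != 0) && (q != 0)).
  by rewrite /askey_wilson aq; case/andP: aq => a0 q0; exact: aw_formula_rec.
apply: askey_wilson_cvg; first by rewrite aq.
have s1 : `|a * b * c * d| < 1 by rewrite !normM_lt1.
apply: cvg_trans (@cvg_aw_rec x a b c d q n q1 s1).
apply: near_eq_cvg; apply: filterS (near_punctured a1 q1) => p [p1 p2 n1 n2].
by rewrite aw_formula_rec.
Qed.

End RemovableSingularities.

Section GeneratingFunctionAlgebra.
Variable C : numFieldType.
Implicit Types (b c d q t x z w : C).

Definition psi x b c d q n : C := aw_rec x 0 b c d q n.

(* aw_beta and the last three factors of aw_gamma at a = 0, with V = q^m. *)
Definition psi_beta b c d q V : C :=
  V * (q * (b + c + d) + b * c * d - b * c * d * q * V - b * c * d * q ^+ 2 * V).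

Definition psi_gamma b c d V : C :=
  (1 - b * c * V) * (1 - b * d * V) * (1 - c * d * V).

Lemma psi1 x b c d q : psi x b c d q 1 = 2 * x - (b + c + d) + b * c * d.
Proof. by rewrite /psi /= /aw_first; field. Qed.

Lemma psiS x b c d q n : psi x b c d q n.+2 =
  (2 * x - psi_beta b c d q (q ^+ n)) * psi x b c d q n.+1
  - (1 - q * q ^+ n) * psi_gamma b c d (q ^+ n) * psi x b c d q n.
Proof.
rewrite /psi aw_recS /aw_beta /aw_gamma /aw_rise /aw_drop /psi_beta /psi_gamma; cbv zeta.
by congr (_ * _ - _ * _); field.
Qed.

Definition psi_term x b c d q t n : C :=
  t ^+ n / qpochs [:: t * b * c * d; q] q n * psi x b c d q n.

Lemma psi_term_telescope x b c d q t N : `|q| < 1 -> `|t * b * c * d| < 1 ->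
  (1 - t * b * c * d) * (1 - 2 * t * x + t ^+ 2)
    * (\sum_(0 <= n < N.+1) psi_term x b c d q t n)
  - (1 - t * b) * (1 - t * c) * (1 - t * d)
    * (\sum_(0 <= n < N.+1) psi_term x b c d q (t * q) n)
  = t ^+ N.+1 / (qpoch (t * b * c * d * q) q N * qpoch q q N)
    * (t * psi_gamma b c d (q ^+ N) * psi x b c d q N
       - (1 - t * b * c * d * q ^+ N) * psi x b c d q N.+1).
Proof.
move=> q1 s1; set s := t * b * c * d.
have Q0 n : qpoch q q n != 0 by rewrite qpoch_neq0.
have s0 n : 1 - s * q ^+ n != 0 by exact: subr_neq0_normMX.
have q0 n : 1 - q * q ^+ n != 0 by exact: subr_neq0_normMX.
have sq : `|s * q| < 1 by rewrite normM_lt1.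
have S0 n : qpoch (s * q) q n != 0 by rewrite qpoch_neq0.
have s0' : 1 - s != 0 by have := s0 0%N; rewrite mulr1.
have T1 n : (1 - s) * psi_term x b c d q t n
  = (1 - s * q ^+ n) * (t ^+ n / (qpoch (s * q) q n * qpoch q q n) * psi x b c d q n).
  rewrite /psi_term !qpochsE -/s qpoch_shift//; field.
  by rewrite Q0 s0' s0 qpoch_neq0.
have T2 n : psi_term x b c d q (t * q) n
  = q ^+ n * (t ^+ n / (qpoch (s * q) q n * qpoch q q n) * psi x b c d q n).
  rewrite /psi_term !qpochsE exprMn.
  have -> : t * q * b * c * d = s * q by rewrite /s; ring.
  by field; rewrite Q0 S0.
elim: N => [|N IH].
  by rewrite !big_nat1 mulrAC T1 T2 !expr0 !qpoch0 psi1 /psi /= /psi_gamma /s; field.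
rewrite !(@big_nat_recr _ _ _ N.+1)//=.
have split0 (A B S T S' T' : C) :
  A * (S + S') - B * (T + T') = (A * S - B * T) + (A * S' - B * T') by ring.
rewrite split0 IH.
have -> : (1 - s) * (1 - 2 * t * x + t ^+ 2) * psi_term x b c d q t N.+1
   = (1 - 2 * t * x + t ^+ 2) * ((1 - s) * psi_term x b c d q t N.+1) by ring.
rewrite T1 T2 psiS !qpochS.
rewrite /psi_gamma /psi_beta !exprS.
move: (psi x b c d q N) (psi x b c d q N.+1) => p0 p1.
have h1 := s0 N.+1; have h2 := q0 N; have h3 := S0 N; have h4 := Q0 N.
rewrite exprS in h1.
move: (qpoch (s * q) q N) (qpoch q q N) h3 h4 => P Q h3 h4.
rewrite /s in h1 *.
by field; rewrite h2 h3 h4 -[_ * q * _]mulrA h1.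
Qed.

Lemma psi_term0 x b c d q t : psi_term x b c d q t 0 = 1.
Proof. by rewrite /psi_term qpochs0 expr0 divr1 mul1r. Qed.

End GeneratingFunctionAlgebra.

Section GeneratingFunction.
Variable R : realType.
Local Notation C := (cplx R).
Implicit Types (a b c d q t u v x z w : C) (K r B : R).

Lemma nm_unit_dist u v r : 0 <= r -> nm (v - 1) <= r -> r <= 1 ->
  nm (u * v - 1) <= 2 * nm (u - 1) + r.
Proof.
move=> r0 vr r1.
rewrite (_ : u * v - 1 = (u - 1) * v + (v - 1)); last by ring.
rewrite (le_trans (nmD _ _))// nmM lerD// mulrC ler_wpM2r ?nm_ge0//.
have := nmD 1 (v - 1); rewrite addrC subrK nm1; lra.
Qed.

Lemma nm_one_sub_dist u V : nm u <= 1 -> nm (1 - u * V - 1) <= nm V.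
Proof.
move=> u1; rewrite addrAC subrr sub0r nmN nmM.
by rewrite ler_piMl ?nm_ge0.
Qed.

Lemma psi_gamma_dist b c d q V : `|b| < 1 -> `|c| < 1 -> `|d| < 1 -> `|q| < 1 ->
  nm V <= 1 -> nm ((1 - q * V) * psi_gamma b c d V - 1) <= 15 * nm V.
Proof.
move=> b1 c1 d1 q1 V1; have V0 := nm_ge0 V.
have le1 u : `|u| < 1 -> nm u <= 1 by rewrite nm_lt1; exact: ltW.
rewrite /psi_gamma !mulrA.
have e u : `|u| < 1 -> nm (1 - u * V - 1) <= nm V by move=> /le1; exact: nm_one_sub_dist.
have h0 := e _ q1.
have h1 := nm_unit_dist (1 - q * V) V0 (e _ (normM_lt1 b1 c1)) V1.
have h2 := nm_unit_dist ((1 - q * V) * (1 - b * c * V)) V0 (e _ (normM_lt1 b1 d1)) V1.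
have h3 := nm_unit_dist ((1 - q * V) * (1 - b * c * V) * (1 - b * d * V)) V0
  (e _ (normM_lt1 c1 d1)) V1.
lra.
Qed.

Lemma psi_beta_bound b c d q : exists2 K : R, 0 <= K &
  forall V, nm V <= 1 -> nm (psi_beta b c d q V) <= K * nm V.
Proof.
pose A := q * (b + c + d) + b * c * d.
pose D := b * c * d * q + b * c * d * q ^+ 2.
exists (nm A + nm D) => [|V V1]; first by rewrite addr_ge0 ?nm_ge0.
have -> : psi_beta b c d q V = (A - D * V) * V by rewrite /psi_beta /A /D; ring.
rewrite nmM ler_wpM2r ?nm_ge0// (le_trans (nmB _ _))// lerD2l nmM.
by rewrite ler_piMr ?nm_ge0.
Qed.

Lemma growth_bound (y : nat -> R) Z K r : 0 <= r < 1 -> 1 <= Z -> 0 <= K ->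
  (forall n, 0 <= y n) -> (forall n, y n.+1 <= (Z + K * r ^+ n) * y n) ->
  forall n, y n <= y 0%N * expR (K / (1 - r)) * Z ^+ n.
Proof.
move=> /andP[r0 r1] Z1 K0 y0 yS.
have s0 : 0 < 1 - r by rewrite subr_gt0.
have Z0 : 0 <= Z by rewrite (le_trans _ Z1).
have h n : y n <= y 0%N * expR (K * (1 - r ^+ n) / (1 - r)) * Z ^+ n.
  elim: n => [|n IH].
    by rewrite !expr0 subrr mulr0 mul0r expR0 !mulr1.
  have -> : K * (1 - r ^+ n.+1) / (1 - r) = K * (1 - r ^+ n) / (1 - r) + K * r ^+ n.
    by rewrite exprS; field; rewrite gt_eqF.
  rewrite (le_trans (yS n))// expRD exprS.
  rewrite [leRHS](_ : _ = (Z * expR (K * r ^+ n)) *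
    (y 0%N * expR (K * (1 - r ^+ n) / (1 - r)) * Z ^+ n)); last by ring.
  have kr : 0 <= K * r ^+ n by rewrite mulr_ge0 ?exprn_ge0.
  rewrite ler_pM// ?addr_ge0//.
  rewrite (@le_trans _ _ (Z * (1 + K * r ^+ n)))//; first nra.
  by rewrite ler_wpM2l// expR_ge1Dx.
move=> n; rewrite (le_trans (h n))// ler_wpM2r ?exprn_ge0// ler_wpM2l//.
rewrite ler_expR ler_pM2r ?invr_gt0// ler_piMr// lerBlDr lerDl.
by rewrite exprn_ge0.
Qed.

(* The recurrence is asymptotically psi_(n+2) = (z + w) psi_(n+1) - psi_n, whose
   characteristic roots are z and w; the two differences below diagonalise it. *)
Lemma psi_growth x b c d q z w : `|b| < 1 -> `|c| < 1 -> `|d| < 1 -> `|q| < 1 ->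
  z + w = 2 * x -> z * w = 1 -> z != w -> nm w <= nm z ->
  exists2 K : R, 0 <= K & forall n, nm (psi x b c d q n) <= K * nm z ^+ n.
Proof.
move=> b1 c1 d1 q1 zw1 zw zDw wz.
have /andP[r0 r1] := nm01 q1.
have Z1 : 1 <= nm z.
  rewrite leNgt; apply/negP => z1; have : nm z * nm w = 1 by rewrite -nmM zw nm1.
  have := nm_ge0 w; nra.
pose p n := psi x b c d q n.
pose y n := nm (p n.+1 - z * p n) + nm (p n.+1 - w * p n).
have zw0 : z - w != 0 by rewrite subr_eq0.
have D0 : 0 < nm (z - w) by rewrite lt_neqAle eq_sym nm_eq0 zw0 nm_ge0.
pose D := (nm (z - w))^-1.
have Dge0 : 0 <= D by rewrite invr_ge0 ltW.
have y0 n : 0 <= y n by rewrite addr_ge0 ?nm_ge0.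
have py n : nm (p n) <= D * y n.
  have -> : p n = (z - w)^-1 * ((p n.+1 - w * p n) - (p n.+1 - z * p n)).
    by field.
  by rewrite nmM nmV ler_wpM2l// /y [leRHS]addrC nmB.
have pSy n : nm (p n.+1) <= D * nm z * y n.
  have -> : p n.+1 = (z - w)^-1 * (z * (p n.+1 - w * p n) - w * (p n.+1 - z * p n)).
    by field.
  rewrite nmM nmV -mulrA ler_wpM2l// (le_trans (nmB _ _))//.
  by rewrite !nmM /y mulrDr [leRHS]addrC lerD// ler_wpM2r ?nm_ge0.
have [Kb Kb0 HB] := psi_beta_bound b c d q.
pose delta n := psi_beta b c d q (q ^+ n) * p n.+1
  + ((1 - q * q ^+ n) * psi_gamma b c d (q ^+ n) - 1) * p n.
pose L := (Kb * (D * nm z) + 15 * D).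
have V1 n : nm (q ^+ n) <= 1 by rewrite nmX exprn_ile1 ?nm_ge0 ?ltW.
have deltaB n : nm (delta n) <= L * nm q ^+ n * y n.
  rewrite (le_trans (nmD _ _))// !(nmM (psi_beta _ _ _ _ _)) (nmM (_ - 1)).
  have h1 := HB _ (V1 n); have h2 := psi_gamma_dist b1 c1 d1 q1 (V1 n).
  rewrite nmX in h1 h2.
  rewrite [leRHS](_ : _ = (Kb * nm q ^+ n) * (D * nm z * y n)
      + (15 * nm q ^+ n) * (D * y n)).
    by rewrite lerD// ler_pM ?nm_ge0.
  by rewrite /L; ring.
have pS n : p n.+2 = (z + w) * p n.+1 - p n - delta n.
  by rewrite /p psiS -zw1 /delta /p; ring.
have yS n : y n.+1 <= (nm z + 2 * L * nm q ^+ n) * y n.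
  have e1 : p n.+2 - z * p n.+1 = w * (p n.+1 - z * p n) - delta n.
    rewrite pS -[p n in X in X - _]mul1r -zw; ring.
  have e2 : p n.+2 - w * p n.+1 = z * (p n.+1 - w * p n) - delta n.
    rewrite pS -[p n in X in X - _]mul1r -zw; ring.
  rewrite {1}/y e1 e2.
  have h1 := nmB (w * (p n.+1 - z * p n)) (delta n).
  have h2 := nmB (z * (p n.+1 - w * p n)) (delta n).
  rewrite nmM in h1; rewrite nmM in h2.
  have h3 : nm w * nm (p n.+1 - z * p n) <= nm z * nm (p n.+1 - z * p n).
    by rewrite ler_wpM2r ?nm_ge0.
  have e3 : nm z * y n = nm z * nm (p n.+1 - z * p n) + nm z * nm (p n.+1 - w * p n).
    by rewrite /y mulrDr.
  by rewrite mulrDl e3; have := deltaB n; lra.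
have L0 : 0 <= 2 * L by rewrite mulr_ge0 ?addr_ge0 ?mulr_ge0 ?nm_ge0.
have g := growth_bound (nm01 q1) Z1 L0 y0 yS.
exists (D * (y 0%N * expR (2 * L / (1 - nm q)))) => [|n].
  by rewrite !mulr_ge0 ?expR_ge0.
by rewrite (le_trans (py n))// -[leRHS]mulrA ler_wpM2l.
Qed.

End GeneratingFunction.

Section GeneratingFunctionLimit.
Variable R : realType.
Local Notation C := (cplx R).
Implicit Types (a b c d q t u v x z w : C) (K r B : R).

Lemma aw_basis_factor_roots x a q z w n : z + w = 2 * x -> z * w = 1 ->
  1 - 2 * a * x * q ^+ n + a ^+ 2 * q ^+ (2 * n)
  = (1 - a * z * q ^+ n) * (1 - a * w * q ^+ n).
Proof.
move=> zw1 zw; rewrite [(2 * n)%N]mulnC exprM.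
transitivity (1 - a * (z + w) * q ^+ n + a ^+ 2 * (z * w) * q ^+ n ^+ 2).
  by rewrite zw1 zw; ring.
by ring.
Qed.

Lemma phi_h_neq0 x a q z w : `|q| < 1 -> z + w = 2 * x -> z * w = 1 ->
  `|a * z| < 1 -> `|a * w| < 1 -> (phi_h x a q)^-1 != 0.
Proof.
move=> q1 zw1 zw az aw.
apply: (prod_geometric_neq0 (nm01 q1) (fun n => @aw_factor_bound R x a q n q1)
   _ (@cvg_aw_basis R x a q q1)) => n.
by rewrite (aw_basis_factor_roots a q n zw1 zw) mulf_neq0// subr_neq0_normMX.
Qed.

Lemma exists_inverse_roots x : `|x| < 1 ->
  exists z w, [/\ z + w = 2 * x, z * w = 1, z != w & nm w <= nm z].
Proof.
move=> x1.
pose y : C := sqrtC (x ^+ 2 - 1).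
have y2 : y ^+ 2 = x ^+ 2 - 1 by exact: sqrtCK.
have y0 : y != 0.
  apply: contraTneq x1 => y0; have : x ^+ 2 = 1.
    by apply/eqP; rewrite -subr_eq0 -y2 y0 expr0n.
  move=> /(congr1 (fun u : C => nm u)); rewrite nmX nm1 nm_lt1 => h.
  by have := nm_ge0 x; rewrite -leNgt; nra.
have zDw : (x + y) != (x - y).
  rewrite -subr_eq0 (_ : x + y - (x - y) = 2 * y); last by ring.
  by rewrite mulf_neq0// pnatr_eq0.
have e1 : (x + y) + (x - y) = 2 * x by ring.
have e2 : (x + y) * (x - y) = 1.
  by rewrite mulrC -subr_sqr y2; ring.
have [le|/ltW le] := leP (nm (x - y)) (nm (x + y)).
  by exists (x + y), (x - y); split.
exists (x - y), (x + y); split => //; first by rewrite addrC.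
  by rewrite mulrC.
by rewrite eq_sym.
Qed.

Lemma solve_div3 (K : fieldType) (s p f n : K) : s != 0 -> p^-1 != 0 ->
  s / p * f = n * 1 -> f = n / s * p.
Proof.
rewrite invr_eq0 => s0 p0; rewrite mulr1 => <-.
by field; rewrite s0 p0.
Qed.

Section Radius.
Variables (x a b c d q z w : C).
Hypotheses (a1 : `|a| < 1) (b1 : `|b| < 1) (c1 : `|c| < 1) (d1 : `|d| < 1)
  (q1 : `|q| < 1) (zw1 : z + w = 2 * x) (zw : z * w = 1) (zDw : z != w)
  (wz : nm w <= nm z) (aw : nm a < nm w).

Let az : nm a * nm z < 1.
Proof.
have e : nm z * nm w = 1 by rewrite -nmM zw nm1.
have z0 : 0 < nm z.
  rewrite lt_neqAle nm_ge0 andbT eq_sym; apply: contraTneq (oner_neq0 R) => z0.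
  by rewrite -e z0 mul0r eqxx.
by rewrite -e [X in _ < X]mulrC ltr_pM2r.
Qed.

Let nm_tbcd t u : nm t <= nm a -> nm u <= 1 ->
  nm (t * b * c * d * u) <= nm (a * b * c * d).
Proof.
move=> ta u1; rewrite nmM (@le_trans _ _ (nm (t * b * c * d)))//.
  by rewrite ler_piMr ?nm_ge0.
by rewrite !nmM !ler_wpM2r ?nm_ge0.
Qed.

Let nm_q : nm q <= 1. Proof. by have /andP[_ /ltW] := nm01 q1. Qed.

Let growth : exists2 K : R, 0 <= K & forall n, nm (psi x b c d q n) <= K * nm z ^+ n.
Proof. exact: psi_growth b1 c1 d1 q1 zw1 zw zDw wz. Qed.

Let qpoch_lower : exists2 e : R, 0 < e & forall t u n, nm t <= nm a -> nm u <= 1 ->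
  nm (qpoch (t * b * c * d * u) q n * qpoch q q n)^-1 <= e^-1.
Proof.
have s01 : 0 <= nm (a * b * c * d) < 1.
  by rewrite nm_ge0 -nm_lt1 !normM_lt1.
have [e1 e10 H1] := qpoch_lower_bound s01 (nm01 q1).
have [e2 e20 H2] := qpoch_lower_bound (nm01 q1) (nm01 q1).
exists (e1 * e2) => [|t u n ta u1]; first by rewrite mulr_gt0.
have h1 := H1 (t * b * c * d * u) q n (nm_tbcd ta u1) (lexx _).
have h2 := H2 q q n (lexx _) (lexx _).
rewrite nmV nmM lef_pV2 ?posrE ?mulr_gt0//.
- by rewrite ler_pM// ltW.
- exact: lt_le_trans h1.
- exact: lt_le_trans h2.
Qed.

Let psi_term_bound : exists2 K : R, 0 <= K & forall t n, nm t <= nm a ->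
  nm (psi_term x b c d q t n) <= K * (nm t * nm z) ^+ n.
Proof.
have [K K0 HK] := growth; have [e e0 He] := qpoch_lower.
exists (e^-1 * K) => [|t n ta]; first by rewrite mulr_ge0// invr_ge0 ltW.
have h := He t 1 n ta; rewrite nm1 mulr1 in h; have {}h := h (lexx _).
rewrite /psi_term !qpochsE nmM [nm (t ^+ n / _)]nmM nmX exprMn.
rewrite [leRHS](_ : _ = (nm t ^+ n * e^-1) * (K * nm z ^+ n)); last by ring.
by rewrite !ler_pM ?mulr_ge0 ?exprn_ge0 ?nm_ge0.
Qed.

Let boundary t N : C :=
  t ^+ N.+1 / (qpoch (t * b * c * d * q) q N * qpoch q q N)
    * (t * psi_gamma b c d (q ^+ N) * psi x b c d q N
       - (1 - t * b * c * d * q ^+ N) * psi x b c d q N.+1).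

Let boundary_bound : exists2 K : R, 0 <= K & forall t N, nm t <= nm a ->
  nm (boundary t N) <= K * (nm t * nm z) ^+ N.
Proof.
have [K K0 HK] := growth; have [e e0 He] := qpoch_lower.
have le1 u : `|u| < 1 -> nm u <= 1 by rewrite nm_lt1; exact: ltW.
exists (e^-1 * (8 * K + 2 * (K * nm z))) => [|t N ta].
  by rewrite mulr_ge0 ?addr_ge0 ?mulr_ge0 ?nm_ge0// invr_ge0 ltW.
have h := He t q N ta nm_q.
have ta1 : nm t <= 1 by rewrite (le_trans ta)// le1.
have V1 : nm (q ^+ N) <= 1 by rewrite nmX exprn_ile1 ?nm_ge0.
have f2 u : nm u <= 1 -> nm (1 - u * q ^+ N) <= 2.
  move=> u1; have uV : nm (u * q ^+ N) <= 1.
    by rewrite nmM mulr_ile1 ?nm_ge0.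
  by have := nmB 1 (u * q ^+ N); rewrite nm1; lra.
have g8 : nm (psi_gamma b c d (q ^+ N)) <= 8.
  rewrite /psi_gamma !nmM.
  have := f2 (b * c) (le1 _ (normM_lt1 b1 c1)).
  have := f2 (b * d) (le1 _ (normM_lt1 b1 d1)).
  have := f2 (c * d) (le1 _ (normM_lt1 c1 d1)).
  move=> h1 h2 h3; rewrite (_ : 8 = 2 * 2 * 2); last by ring.
  by rewrite !ler_pM ?mulr_ge0 ?nm_ge0.
have s2 : nm (1 - t * b * c * d * q ^+ N) <= 2.
  apply: f2; rewrite -[t * b * c * d]mulr1 (le_trans (nm_tbcd ta _)) ?nm1//.
  by rewrite le1// !normM_lt1.
rewrite /boundary nmM [nm (t ^+ _ / _)]nmM nmX.
rewrite [leRHS](_ : _ = (nm t ^+ N * e^-1) *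
    (8 * (K * nm z ^+ N) + 2 * (K * nm z ^+ N.+1))); last first.
  by rewrite exprMn exprS; ring.
rewrite ler_pM ?mulr_ge0 ?exprn_ge0 ?nm_ge0//.
  by rewrite ler_pM ?exprn_ge0 ?nm_ge0// ler_wiXn2l ?nm_ge0.
rewrite (le_trans (nmB _ _))// lerD// nmM ler_pM ?nm_ge0//.
by rewrite nmM -[leRHS]mul1r ler_pM ?nm_ge0.
Qed.

Let F t : C := lim (series (psi_term x b c d q t) @ \oo).

Let F_spec : exists2 K : R, 0 <= K & forall t, nm t <= nm a ->
  (series (psi_term x b c d q t) @ \oo --> F t) /\ nm (F t - 1) <= K * nm t.
Proof.
have [K K0 HK] := psi_term_bound.
have s0 : 0 < 1 - nm a * nm z by rewrite subr_gt0.
exists (K / (1 - nm a * nm z) * nm z) => [|t ta].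
  by rewrite !mulr_ge0 ?invr_ge0 ?nm_ge0// ltW.
have tz : nm t * nm z <= nm a * nm z by rewrite ler_wpM2r ?nm_ge0.
have tz1 : 0 <= nm t * nm z < 1 by rewrite mulr_ge0 ?nm_ge0//= (le_lt_trans tz).
have [l cl Hl] := cvg_geometric_bound tz1 (fun n => HK t n ta).
have Fl : F t = l by apply: cvg_lim => //; exact: norm_hausdorff.
rewrite Fl; split => //.
have := Hl 1%N; rewrite /series/= big_nat1 psi_term0 expr1 => h.
rewrite (le_trans h)// -[leRHS]mulrA [nm z * _]mulrC ler_wpM2r ?mulr_ge0 ?nm_ge0//.
rewrite ler_wpM2l// lef_pV2 ?posrE//; lra.
Qed.

Let F_shift t : nm t <= nm a ->
  (1 - t * b * c * d) * (1 - 2 * t * x + t ^+ 2) * F t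
  = (1 - t * b) * (1 - t * c) * (1 - t * d) * F (t * q).
Proof.
move=> ta; have [K K0 HK] := boundary_bound.
have [K' _ HF] := F_spec.
have /andP[r0 r1] := nm01 q1.
have tqa : nm (t * q) <= nm a.
  by rewrite nmM (le_trans _ ta)// ler_piMr ?nm_ge0// ltW.
have tz : nm t * nm z <= nm a * nm z by rewrite ler_wpM2r ?nm_ge0.
have tz1 : `|nm t * nm z| < 1.
  by rewrite ger0_norm ?mulr_ge0 ?nm_ge0// (le_lt_trans tz).
have [[c1t _] [c2t _]] := (HF _ ta, HF _ tqa).
apply/eqP; rewrite -subr_eq0; apply/eqP.
have b0 : boundary t n @[n --> \oo] --> (0 : C).
  apply: (@cvg_nm _ _ _ (fun n => K * (nm t * nm z) ^+ n)) => [n|].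
    by rewrite nm_distC subr0; exact: HK.
  rewrite -[X in _ --> X](mulr0 K); apply: cvgM; first exact: cvg_cst.
  exact: cvg_expr.
pose A := (1 - t * b * c * d) * (1 - 2 * t * x + t ^+ 2).
pose B := (1 - t * b) * (1 - t * c) * (1 - t * d).
have s1 : `|t * b * c * d| < 1.
  have t1 : `|t| < 1 by rewrite nm_lt1 (le_lt_trans ta)// -nm_lt1.
  by rewrite !normM_lt1.
have bE n : boundary t n = A * series (psi_term x b c d q t) n.+1
   - B * series (psi_term x b c d q (t * q)) n.+1.
  by rewrite /boundary -psi_term_telescope.
have : boundary t n @[n --> \oo] --> A * F t - B * F (t * q).
  under eq_fun do rewrite bE.
  apply: cvgB; apply: cvgM; try exact: cvg_cst.
    by rewrite -cvg_shiftS in c1t.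
  by rewrite -cvg_shiftS in c2t.
by move=> h; exact: (@cvg_unique _ (@norm_hausdorff _ _) _ _ _ _ h b0).
Qed.

Let F_iter N : qpoch (a * b * c * d) q N * aw_basis x a q N * F a
  = qpoch (a * b) q N * qpoch (a * c) q N * qpoch (a * d) q N * F (a * q ^+ N).
Proof.
elim: N => [|N IH]; first by rewrite !qpoch0 aw_basis0 expr0 !mul1r mulr1.
have tN : nm (a * q ^+ N) <= nm a.
  by rewrite nmM ler_piMr ?nm_ge0// nmX exprn_ile1 ?nm_ge0// ltW// -nm_lt1.
have := F_shift tN.
have -> : a * q ^+ N * q = a * q ^+ N.+1 by rewrite exprSr mulrA.
rewrite !qpochS aw_basisS mulnC exprM => h.
transitivity ((1 - a * q ^+ N * b * c * d)
  * (1 - 2 * (a * q ^+ N) * x + (a * q ^+ N) ^+ 2)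
  * (qpoch (a * b * c * d) q N * aw_basis x a q N * F a)); first by ring.
rewrite IH mulrCA h; ring.
Qed.

Lemma generating_function_cvg_roots :
  series (psi_term x b c d q a) @ \oo -->
  qpochsoo [:: a * b; a * c; a * d] q / qpochoo (a * b * c * d) q * phi_h x a q.
Proof.
have [K K0 HF] := F_spec.
have /andP[r0 r1] := nm01 q1.
have [ca _] := HF a (lexx _).
suff <- : F a = qpochsoo [:: a * b; a * c; a * d] q
    / qpochoo (a * b * c * d) q * phi_h x a q by [].
have F1 : F (a * q ^+ n) @[n --> \oo] --> (1 : C).
  apply: (@cvg_nm _ _ _ (fun n => (K * nm a) * nm q ^+ n)) => [n|].
    have tN : nm (a * q ^+ n) <= nm a.
      by rewrite nmM ler_piMr ?nm_ge0// nmX exprn_ile1 ?nm_ge0// ltW// -nm_lt1.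
    by have [_] := HF _ tN; rewrite nm_distC nmM nmX mulrA.
  rewrite -[X in _ --> X](mulr0 (K * nm a)); apply: cvgM; first exact: cvg_cst.
  by apply: cvg_expr; rewrite ger0_norm.
have l1 : qpoch (a * b * c * d) q N * aw_basis x a q N * F a @[N --> \oo]
  --> qpochoo (a * b * c * d) q * (phi_h x a q)^-1 * F a.
  apply: cvgM; last exact: cvg_cst.
  by apply: cvgM; [exact: cvg_qpoch|exact: cvg_aw_basis].
have l2 : qpoch (a * b * c * d) q N * aw_basis x a q N * F a @[N --> \oo]
  --> qpochoo (a * b) q * qpochoo (a * c) q * qpochoo (a * d) q * 1.
  under eq_fun do rewrite F_iter.
  apply: cvgM; last exact: F1.
  by apply: cvgM; [apply: cvgM|]; exact: cvg_qpoch.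
have E := @cvg_unique _ (@norm_hausdorff _ _) _ _ _ _ l1 l2.
have s0 : qpochoo (a * b * c * d) q != 0 by rewrite qpochoo_neq0 ?normM_lt1.
have az1 : `|a * z| < 1 by rewrite nm_lt1 nmM.
have aw1 : `|a * w| < 1.
  by rewrite nm_lt1 nmM (le_lt_trans _ az)// ler_wpM2l ?nm_ge0.
have p0 := @phi_h_neq0 x a q z w q1 zw1 zw az1 aw1.
by rewrite qpochsoo3; exact: (solve_div3 s0 p0 (E _)).
Qed.

End Radius.
End GeneratingFunctionLimit.

Lemma ratio_AW_CH (F : fieldType) (h pa pb pc pd P Q s : F) :
  Q * h * pb * pc * pd != 0 ->
  h * pa * pb * pc * pd * (P * Q / s) / (Q * h * pb * pc * pd) = P / s * pa.
Proof.
rewrite !mulf_eq0 !negb_or => /andP[/andP[/andP[/andP[Q0 h0] b0] c0] d0].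
by move: s^-1 => s'; field; rewrite Q0 h0 b0 c0 d0.
Qed.

Lemma inv_ratio_mul (F : fieldType) (p s f : F) : (p / s * f)^-1 = s / (p * f).
Proof. by rewrite invfM invf_div -mulrA -invfM. Qed.

Lemma f_AW_div_f_CH (R : realType) (x a b c d q : cplx R) :
  f_CH x b c d q != 0 ->
  f_AW x a b c d q / f_CH x b c d q
  = qpochsoo [:: a * b; a * c; a * d] q / qpochoo (a * b * c * d) q * phi_h x a q.
Proof.
have -> : f_AW x a b c d q = f_h x q * phi_h x a q * phi_h x b q * phi_h x c q
  * phi_h x d q * (qpochsoo [:: a * b; a * c; a * d] q
    * qpochsoo [:: b * c; b * d; c * d] q / qpochoo (a * b * c * d) q).
  by rewrite /f_AW /qpochsoo -big_cat.
exact: ratio_AW_CH.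
Qed.

Section DegenerateExpansion.
Variable R : realType.
Local Notation C := (cplx R).
Variables x a b c d q : C.
Hypotheses (a1 : `|a| < 1) (b1 : `|b| < 1) (c1 : `|c| < 1) (d1 : `|d| < 1)
  (q1 : `|q| < 1).

Let term n : C := (- a) ^+ n * q ^+ 'C(n, 2)
        * (qpoch (a * b * c * d) q (2 * n)
           / qpochs [:: a * b; a * c; a * d; q] q n)
        * askey_wilson n x a b c d q.

Let ratio n : C := qpoch (a * b * c * d) q n *
  (aw_basis x a q n / (qpoch (a * b) q n * qpoch (a * c) q n * qpoch (a * d) q n)).

Let cvg_ratio : ratio n @[n --> \oo] --> qpochoo (a * b * c * d) q
      / (qpochsoo [:: a * b; a * c; a * d] q * phi_h x a q).
Proof.
rewrite qpochsoo3 div_prod3.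
by apply: cvgM; [exact: cvg_qpoch|exact: cvg_basis_ratio].
Qed.

Let term0 : term 0 = 1.
Proof.
by rewrite /term askey_wilsonE//= qpochs0 muln0 qpoch0 !expr0 !mulr1 invr1 !mulr1.
Qed.

Lemma inverse_expansion_a0 : a = 0 -> series term @ \oo -->
  qpochoo (a * b * c * d) q / (qpochsoo [:: a * b; a * c; a * d] q * phi_h x a q).
Proof.
move=> a0; rewrite -cvg_shiftS.
have q0 n : qpoch 0 q n = 1 :> C by rewrite /qpoch big1// => k _; rewrite mul0r subr0.
have B0 n : aw_basis x 0 q n = 1.
  by rewrite /aw_basis big1// => k _; rewrite expr0n/= mulr0 !mul0r subr0 addr0.
have E n : series term n.+1 = ratio n.
  rewrite /series/= big_nat_recl// term0 big1 ?addr0 => [|k _].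
    by rewrite /ratio a0 !mul0r !q0 B0 !(mulr1, invr1).
  by rewrite /term a0 oppr0 expr0n/= !mul0r.
under eq_fun do rewrite E.
exact: cvg_ratio.
Qed.

Lemma inverse_expansion_q0 : q = 0 -> series term @ \oo -->
  qpochoo (a * b * c * d) q / (qpochsoo [:: a * b; a * c; a * d] q * phi_h x a q).
Proof.
move=> q0.
have Q u n : qpoch u 0 n.+1 = 1 - u :> C.
  rewrite /qpoch big_nat_recl// expr0 mulr1 big1 ?mulr1// => k _.
  by rewrite expr0n/= mulr0 subr0.
have B n : aw_basis x a 0 n.+1 = 1 - 2 * a * x + a ^+ 2.
  rewrite /aw_basis big_nat_recl// !expr0 !mulr1 big1 ?mulr1// => k _.
  by rewrite mulnS !expr0n/= !mulr0 subr0 addr0.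
have T k : term k.+2 = 0.
  rewrite /term q0 binS bin1 addnS expr0n/= mulr0 !mul0r //.
have E n : series term n.+2 = ratio n.+1.
  rewrite /series/= !big_nat_recl// term0 big1 ?addr0 => [|k _]; last exact: T.
  rewrite /term askey_wilsonE// /= /aw_first /ratio q0 !qpochsE B.
  rewrite ?(expr0, expr1, Q, qpoch1).
  by field; rewrite !subr_neq0_norm ?normM_lt1.
have h : series term n.+2 @[n --> \oo] --> qpochoo (a * b * c * d) q
    / (qpochsoo [:: a * b; a * c; a * d] q * phi_h x a q).
  by under eq_fun do rewrite E; have := cvg_ratio; rewrite -cvg_shiftS.
by rewrite -cvg_shiftS -cvg_shiftS; exact: h.
Qed.

End DegenerateExpansion.

Lemma generating_function_cvg (R : realType) (x a b c d q : cplx R) :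
  `|x| < 1 -> `|a| < 1 -> `|b| < 1 -> `|c| < 1 -> `|d| < 1 -> `|q| < 1 ->
  (forall z : cplx R, z ^+ 2 - 2 * x * z + 1 = 0 -> `|a| < `|z|) ->
  series (psi_term x b c d q a) @ \oo -->
  qpochsoo [:: a * b; a * c; a * d] q / qpochoo (a * b * c * d) q * phi_h x a q.
Proof.
move=> x1 a1 b1 c1 d1 q1 ax.
have [z [w [zw1 zw zDw wz]]] := exists_inverse_roots x1.
have aw : nm a < nm w.
  rewrite -lt_nm; apply: ax; rewrite -zw1 -zw; ring.
exact: (generating_function_cvg_roots a1 b1 c1 d1 q1 zw1 zw zDw wz aw).
Qed.

Theorem theorem10 (R : realType) (x a b c d q : cplx R)
    (hx : `|x| < 1) (ha : `|a| < 1) (hb : `|b| < 1) (hc : `|c| < 1)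
    (hd : `|d| < 1) (hq : `|q| < 1) :
  [/\ f_CH x b c d q != 0 ->
        f_AW x a b c d q / f_CH x b c d q
        = qpochsoo [:: a * b; a * c; a * d] q / qpochoo (a * b * c * d) q
          * phi_h x a q,
      (forall z : cplx R, z ^+ 2 - 2 * x * z + 1 = 0 -> `|a| < `|z|) ->
        series (fun n : nat =>
          a ^+ n / qpochs [:: a * b * c * d; q] q n * cdual_qhahn n x b c d q)
        @ \oo -->
        qpochsoo [:: a * b; a * c; a * d] q / qpochoo (a * b * c * d) q
        * phi_h x a q,
      f_CH x b c d q != 0 ->
        f_CH x b c d q / f_AW x a b c d q
        = qpochoo (a * b * c * d) q
          / (qpochsoo [:: a * b; a * c; a * d] q * phi_h x a q)
    & series (fun n : nat =>
        (- a) ^+ n * q ^+ 'C(n, 2)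
        * (qpoch (a * b * c * d) q (2 * n)
           / qpochs [:: a * b; a * c; a * d; q] q n)
        * askey_wilson n x a b c d q)
      @ \oo -->
      qpochoo (a * b * c * d) q
      / (qpochsoo [:: a * b; a * c; a * d] q * phi_h x a q)].
Proof.
split.
- exact: f_AW_div_f_CH.
- move=> ax.
  have -> : (fun n : nat =>
      a ^+ n / qpochs [:: a * b * c * d; q] q n * cdual_qhahn n x b c d q)
      = psi_term x b c d q a.
    by apply/funext => n; rewrite /cdual_qhahn askey_wilsonE// normr0; exact: ltr01.
  exact: generating_function_cvg.
- move=> CH0; have := f_AW_div_f_CH a CH0 => /(congr1 (fun u => u^-1)).
  by rewrite invf_div inv_ratio_mul.
- have [a0|a0] := eqVneq a 0; first exact: inverse_expansion_a0.
  have [q0|q0] := eqVneq q 0; first exact: inverse_expansion_q0.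
  have aw n : askey_wilson n x a b c d q = askey_wilson_formula n x a b c d q.
    by rewrite /askey_wilson a0 q0.
  under eq_fun do rewrite aw.
  exact: inverse_expansion_cvg.
Qed.
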